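(* Let $E$, $\mu$ and the semigroup $(T_t)_{t>0}$ with potential operator $G$ be as in the context. If $(T_t)_{t>0}$ is transient, then there exists a function $g\in L^1(E,\mu)_b$ with $g>0$ $\mu$-a.e. and $Gg\in L^\infty(E,\mu)$.
   Context: $E$ is a Hausdorff topological space whose Borel $\sigma$-algebra $\mathcal{B}(E)$ is generated by the continuous functions on $E$; $\mu$ is a $\sigma$-finite positive measure on $\mathcal{B}(E)$; $\mathcal{H}:=L^2(E,\mu)$ with inner product $(\cdot,\cdot)$. For a set $W$ of functions on $E$, $W_b$ denotes the set of $\mu$-a.e. bounded elements of $W$. An operator $S$ is sub-Markovian if $0\le f\le 1$ implies $0\le Sf\le 1$; a resolvent $(G_\alpha)_{\alpha>0}$ is sub-Markovian if all $\alpha G_\alpha$ are. Framework. A (not necessarily symmetric) Dirichlet form on $\mathcal{H}$ is a bilinear form $\mathcal{A}$ on a dense linear subspace $\mathcal{V}\subset\mathcal{H}$ with $\mathcal{A}(u,u)\ge 0$, such that $\mathcal{V}$ is complete for the norm $\|u\|_{\mathcal{V}}=(\mathcal{A}(u,u)+(u,u))^{1/2}$, the weak sector condition $|\mathcal{A}_1(u,v)|\le K\mathcal{A}_1(u,u)^{1/2}\mathcal{A}_1(v,v)^{1/2}$ holds for some $K>0$ (with $\mathcal{A}_1=\mathcal{A}+(\cdot,\cdot)$), and for all $u\in\mathcal{V}$: $u^+\wedge 1\in\mathcal{V}$, $\mathcal{A}(u+u^+\wedge 1,u-u^+\wedge 1)\ge 0$ and $\mathcal{A}(u-u^+\wedge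 1,u+u^+\wedge 1)\ge 0$. Let $(\mathcal{A},\mathcal{V})$ be such a form, $\mathcal{V}'$ the dual of $\mathcal{V}$ (with $\mathcal{V}\subset\mathcal{H}\subset\mathcal{V}'$), and $(\Lambda,D(\Lambda,\mathcal{H}))$ a linear operator on $\mathcal{H}$ which generates a sub-Markovian $C_0$-semigroup of contractions on $\mathcal{H}$ that can be restricted to a $C_0$-semigroup on $\mathcal{V}$. Then $\Lambda:D(\Lambda,\mathcal{H})\cap\mathcal{V}\to\mathcal{V}'$ is closable as an operator from $\mathcal{V}$ to $\mathcal{V}'$; its closure is denoted $(\Lambda,\mathcal{F})$. The associated generalized Dirichlet form satisfies $\mathcal{E}(u,v)=\mathcal{A}(u,v)-{}_{\mathcal{V}'}\langle\Lambda u,v\rangle_{\mathcal{V}}$ for $u\in\mathcal{F}$, $v\in\mathcal{V}$. $(G_\alpha)_{\alpha>0}$ is the sub-Markovian $C_0$-resolvent of contractions on $\mathcal{H}$ with $G_\alpha(\mathcal{H})\subset\mathcal{F}$ and $\mathcal{E}(G_\alpha f,g)+\alpha(G_\alpha f,g)=(f,g)$ for $f\in\mathcal{H}$, $g\in\mathcal{V}$; $(\widehat{G}_\alpha)_{\alpha>0}$ is its adjoint; $(T_t)_{t>0}$ and $(\widehat{T}_t)_{t>0}$ are the $C_0$-semigroups of contractions corresponding to $(G_\alpha)_{\alpha>0}$ and $(\widehat{G}_\alpha)_{\alpha>0}$. It is assumed that $(\widehat{T}_t)_{t>0}$ is sub-Markovian. Hence $(T_t)_{t>0}$ restricted to $L^1(E,\mu)\cap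 L^2(E,\mu)$ extends to a positivity preserving semigroup of contractions on $L^1(E,\mu)$, also denoted $(T_t)_{t>0}$. Potential operator and transience. For $f\in L^1(E,\mu)$, $f\ge 0$, the potential operator is $Gf:=\lim_{N\to\infty}\int_0^N T_tf\,dt=\lim_{\alpha\to 0}\int_0^\infty e^{-\alpha t}T_tf\,dt\in[0,\infty]$ ($\mu$-a.e. defined). $(T_t)_{t>0}$ is transient if there is $g\in L^1(E,\mu)$, $g>0$ $\mu$-a.e., with $Gg<\infty$ $\mu$-a.e. *)

(* Defs.v *)
From mathcomp Require Import all_boot all_order all_algebra.
From mathcomp Require Import all_classical all_reals all_analysis.

Set Implicit Arguments.
Unset Strict Implicit.
Unset Printing Implicit Defensive.

Import Order.TTheory GRing.Theory Num.Theory.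
Import numFieldNormedType.Exports.

Local Open Scope classical_set_scope.
Local Open Scope ring_scope.

(* Elements of L^p(mu) and of its subspaces are represented by functions
   f : T -> R; two functions stand for the same element when they are equal
   mu-a.e.  Accordingly, subspaces are sets of functions that are saturated
   for a.e. equality, operators and forms are required to respect a.e.
   equality, and identities between functions are stated a.e. *)

Notation borel E := (g_sigma_algebraType (@open E)).

Definition borel_generated_by_continuous (R : realType)
    (E : ptopologicalType) : Prop :=
  <<s @open E >> =
  <<s [set f @^-1` B | f in [set f : E -> R | continuous f]
                     & B in [set B : set R | measurable B]] >>.

Section function_spaces.
Context d (T : measurableType d) (R : realType).
Variable mu : {measure set T -> \bar R}.
Implicit Types (f g h u v w : T -> R) (X V D : set (T -> R)).
Implicit Types (nrm : (T -> R) -> R).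

Definition Lp (p : \bar R) : set (T -> R) := [set f | f \in Lfun mu p].

Definition Lp_norm (p : \bar R) f : R := fine ('N[mu]_p[EFin \o f])%E.

Definition ip f g : R := \int[mu]_x (f x * g x).

Definition ae_bounded f : Prop :=
  exists M : R, \forall x \ae mu, `|f x| <= M.

Definition subspace_of X V : Prop :=
  [/\ V `<=` X,
      V 0,
      forall (a : R) u v, V u -> V v -> V (a *: u + v) &
      forall u v, V u -> X v -> u = v %[ae mu] -> V v].

Record operator_on X (S : (T -> R) -> T -> R) : Prop := {
  operator_stable : forall f, X f -> X (S f) ;
  operator_ae : forall f g, X f -> X g -> f = g %[ae mu] ->
    S f = S g %[ae mu] ;
  operator_linear : forall (a : R) f g, X f -> X g ->
    S (a *: f + g) = a *: S f + S g %[ae mu] }.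

Definition bounded_on X nrm (S : (T -> R) -> T -> R) : Prop :=
  exists M : R, forall f, X f -> nrm (S f) <= M * nrm f.

Definition contraction_on X nrm (S : (T -> R) -> T -> R) : Prop :=
  forall f, X f -> nrm (S f) <= nrm f.

Definition positivity_preserving X (S : (T -> R) -> T -> R) : Prop :=
  forall f, X f -> (\forall x \ae mu, 0 <= f x) ->
    \forall x \ae mu, 0 <= S f x.

Definition sub_markovian (S : (T -> R) -> T -> R) : Prop :=
  forall f, Lp 2%:E f -> (\forall x \ae mu, 0 <= f x <= 1) ->
    \forall x \ae mu, 0 <= S f x <= 1.

Definition semigroup_on X (S : R -> (T -> R) -> T -> R) : Prop :=
  (forall t, 0 < t -> operator_on X (S t)) /\
  (forall s t f, 0 < s -> 0 < t -> X f ->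
    S (s + t) f = S s (S t f) %[ae mu]).

Definition C0_semigroup X nrm (S : R -> (T -> R) -> T -> R) : Prop :=
  [/\ semigroup_on X S,
      forall t, 0 < t -> bounded_on X nrm (S t) &
      forall f, X f -> nrm (S t f - f) @[t --> 0^'+] --> (0 : R)].

Definition contraction_semigroup X nrm (S : R -> (T -> R) -> T -> R) : Prop :=
  semigroup_on X S /\ forall t, 0 < t -> contraction_on X nrm (S t).

Definition C0_contraction_semigroup X nrm (S : R -> (T -> R) -> T -> R)
    : Prop :=
  C0_semigroup X nrm S /\ forall t, 0 < t -> contraction_on X nrm (S t).

(* w is the derivative at 0 of t |-> S t u, in the norm nrm. *)
Definition generator_graph X nrm (S : R -> (T -> R) -> T -> R) u w : Prop :=
  [/\ X u, X w &
      nrm (t^-1 *: (S t u - u) - w) @[t --> 0^'+] --> (0 : R)].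

Definition generates X nrm D (L : (T -> R) -> T -> R)
    (S : R -> (T -> R) -> T -> R) : Prop :=
  D = [set u | exists w, generator_graph X nrm S u w] /\
  forall u, D u -> generator_graph X nrm S u (L u).

Definition C0_contraction_resolvent X nrm (G : R -> (T -> R) -> T -> R)
    : Prop :=
  [/\ forall a, 0 < a -> operator_on X (G a),
      forall a, 0 < a -> contraction_on X nrm (fun f => a *: G a f),
      forall a b f, 0 < a -> 0 < b -> X f ->
        G a f - G b f = (b - a) *: G a (G b f) %[ae mu] &
      forall f, X f -> nrm (a *: G a f - f) @[a --> +oo] --> (0 : R)].

Definition adjoint_on_L2 (S S' : (T -> R) -> T -> R) : Prop :=
  operator_on (Lp 2%:E) S' /\
  forall f g, Lp 2%:E f -> Lp 2%:E g -> ip (S f) g = ip f (S' g).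

(* h is the Bochner integral over I, with respect to Lebesgue measure, of the
   X-valued function F: the k-th approximating simple function is
   t |-> \sum_(i < n k) 1_{A k i}(t) x k i. *)
Definition is_bochner_integral X nrm (I : set R) (F : R -> T -> R) h
    : Prop :=
  X h /\
  exists (n : nat -> nat) (A : nat -> nat -> set R) (x : nat -> nat -> T -> R),
    let s k t := \sum_(i < n k) \1_(A k i) t *: x k i in
    let leb := @lebesgue_measure R in
    [/\ forall k i, (i < n k)%N ->
          [/\ measurable (A k i), A k i `<=` I, (leb (A k i) < +oo)%E &
              X (x k i)],
        forall k, measurable_fun I (fun t => nrm (F t - s k t)),
        \forall t \ae leb, I t -> nrm (F t - s k t) @[k --> \oo] --> (0 : R),
        (\int[leb]_(t in I) (nrm (F t - s k t))%:E)%E @[k --> \oo]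
          --> (0 : \bar R)%E &
        nrm ((\sum_(i < n k) fine (leb (A k i)) *: x k i) - h) @[k --> \oo]
          --> (0 : R)].

(* S is the semigroup whose resolvent is G, i.e. G is the Laplace transform
   of S. *)
Definition resolvent_of_semigroup X nrm (S G : R -> (T -> R) -> T -> R)
    : Prop :=
  forall a f, 0 < a -> X f ->
    is_bochner_integral X nrm `]0, +oo[ (fun t => expR (- (a * t)) *: S t f)
      (G a f).

(* Gf is (a version of) the potential lim_N \int_0^N S_t f dt of f in
   L^1(mu).  The integrals are L^1-valued and each is only defined up to a
   null set; as they increase with N when f >= 0, the limit is taken along
   integers. *)
Definition is_potential (S : R -> (T -> R) -> T -> R) f (Gf : T -> \bar R)
    : Prop :=
  exists J : nat -> T -> R,
    (forall N, is_bochner_integral (Lp 1%E) (Lp_norm 1%E) `]0, N%:R[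
       (fun t => S t f) (J N)) /\
    \forall x \ae mu, (J N x)%:E @[N --> \oo] --> Gf x.

Definition transient (S : R -> (T -> R) -> T -> R) : Prop :=
  exists g Gg, [/\ Lp 1%E g,
    \forall x \ae mu, 0 < g x,
    is_potential S g Gg &
    \forall x \ae mu, (Gg x < +oo)%E].

Definition unit_contraction u : T -> R :=
  fun x => Num.min (Num.max (u x) 0) 1.

Section dirichlet.
Variables (A : (T -> R) -> (T -> R) -> R) (V : set (T -> R)).

Definition form1 u v : R := A u v + ip u v.

Definition form_norm u : R := Num.sqrt (form1 u u).

Record dirichlet_form : Prop := {
  form_domain : subspace_of (Lp 2%:E) V ;
  form_dense : forall f (e : R), Lp 2%:E f -> 0 < e ->
    exists2 v, V v & Lp_norm 2%:E (f - v) < e ;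
  form_ae : forall u u' v v', V u -> V u' -> V v -> V v' ->
    u = u' %[ae mu] -> v = v' %[ae mu] -> A u v = A u' v' ;
  form_linearl : forall (a : R) u u' v, V u -> V u' -> V v ->
    A (a *: u + u') v = a * A u v + A u' v ;
  form_linearr : forall (a : R) u v v', V u -> V v -> V v' ->
    A u (a *: v + v') = a * A u v + A u v' ;
  form_ge0 : forall u, V u -> 0 <= A u u ;
  form_complete : forall un : nat -> T -> R, (forall n, V (un n)) ->
    (forall e : R, 0 < e -> exists N : nat, forall m n,
       (N <= m)%N -> (N <= n)%N -> form_norm (un m - un n) < e) ->
    exists2 u, V u & form_norm (un n - u) @[n --> \oo] --> (0 : R) ;
  form_sector : exists2 K : R, 0 < K & forall u v, V u -> V v ->
    `|form1 u v| <= K * Num.sqrt (form1 u u) * Num.sqrt (form1 v v) ;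
  form_unit : forall u, V u -> let u1 := unit_contraction u in
    [/\ V u1, 0 <= A (u + u1) (u - u1) & 0 <= A (u - u1) (u + u1)] }.

(* Elements of V' are functions l : (T -> R) -> R; only the values of l on V
   matter. *)
Definition in_dual (l : (T -> R) -> R) : Prop :=
  (forall (a : R) u v, V u -> V v -> l (a *: u + v) = a * l u + l v) /\
  exists C : R, forall v, V v -> `|l v| <= C * form_norm v.

Definition dual_norm (l : (T -> R) -> R) : \bar R :=
  ereal_sup [set (`|l v|)%:E | v in [set v | V v /\ form_norm v <= 1]].

Variables (D : set (T -> R)) (L : (T -> R) -> T -> R).

(* Graph of the closure of L : D `&` V -> V', where H is embedded in V' by
   f |-> ip f. *)
Definition closure_graph u (l : (T -> R) -> R) : Prop :=
  [/\ V u, in_dual l &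
    exists un : nat -> T -> R,
      [/\ forall n, D (un n) /\ V (un n),
          form_norm (un n - u) @[n --> \oo] --> (0 : R) &
          dual_norm (fun v => ip (L (un n)) v - l v) @[n --> \oo]
            --> (0 : \bar R)%E]].

Definition closure_domain : set (T -> R) :=
  [set u | exists l, closure_graph u l].

(* The closure of L.  L being closable, the element of V' so chosen is the
   only one in relation with u. *)
Definition closure_op u : (T -> R) -> R := xget (fun=> 0) (closure_graph u).

Definition generalized_form u v : R := A u v - closure_op u v.

Definition resolvent_of_form (G : R -> (T -> R) -> T -> R) : Prop :=
  forall a f, 0 < a -> Lp 2%:E f -> closure_domain (G a f) /\
    forall g, V g -> generalized_form (G a f) g + a * ip (G a f) g = ip f g.

End dirichlet.

End function_spaces.

(* Main.v *)
(* Let f <= 1 be positive a.e. and integrable with finite potential Gf, and let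
   u = G_a f.  Since s / (1 + s) is concave and b G_(a+b) is sub-Markovian,
   Jensen's inequality and the resolvent identity give
     u/(1+u) - b G_(a+b) (u/(1+u)) >= (1+u)^-2 G_(a+b) f.
   Applying b G_a and letting b tend to infinity yields G_a ((1+u)^-2 f) <= 1.
   As G_a f <= Gf, the function g = (1+Gf)^-2 f satisfies G_a g <= 1 for every
   a > 0, whence
     int_0^N T_t g dt <= e int_0^oo e^(-t/N) T_t g dt = e G_(1/N) g <= e.
   The L^1-valued integrals of T_t g exist because T_t g -> g also in L^1 as
   t -> 0: this follows from the L^2 convergence together with T_t g >= 0 and
   the L^1 contractivity.  Bochner integrals are compared after pairing with
   nonnegative test functions dominated by f. *)

Require Import Defs.
From mathcomp Require Import all_boot all_order all_algebra.
From mathcomp Require Import all_classical all_reals all_analysis.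
From mathcomp Require Import measurable_realfun ess_sup_inf.
From mathcomp Require Import ring lra.

Set Implicit Arguments.
Unset Strict Implicit.
Unset Printing Implicit Defensive.

Import Order.TTheory GRing.Theory Num.Theory.
Import numFieldNormedType.Exports.

Local Open Scope classical_set_scope.
Local Open Scope ring_scope.

(** * Functions in L^1 and L^2 *)

Section Lp_basics.
Context d (T : measurableType d) (R : realType).
Variable mu : {measure set T -> \bar R}.
Implicit Types (f g h w : T -> R) (a : R).

(** The weight comes from the chain rule. Let L be the generator, phi concave with phi(0) = 0 and u
    = G_a f. Formally (a - L) phi(u) >= phi'(u) f, hence G_a (phi'(u) f) <= phi(u). The choice
    phi(s) = s / (1 + s) is bounded by 1 and has a positive decreasing derivative: the weight never
    vanishes, and u may be replaced by the larger Gf, which does not depend on a. Working with b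
    G_(a+b) instead of L avoids asking whether phi(u) lies in a domain. Two obstacles shape the
    rest. The potential is built from L^1-valued integrals and the resolvent from L^2-valued ones. A
    function between 0 and f is bounded and square integrable, so it pairs with both, and since f >
    0 a.e. such functions decide a.e. inequalities. Moreover, [is_potential] demands actual Bochner
    integrals in L^1, whereas the semigroup on L^1 is given as contractive without strong
    continuity; the continuity in L^1 has to be recovered for the particular function g. *)

Lemma Lp1P f : Lp mu 1 f <-> mu.-integrable setT (EFin \o f).
Proof. exact: Lfun1_integrable. Qed.

Lemma Lp_measurable p f : Lp mu p f -> measurable_fun setT f.
Proof. by move=> /andP[/[!inE]]. Qed.

Lemma Lp2P f : Lp mu 2%:E f <->
  measurable_fun setT f /\ mu.-integrable setT (EFin \o (fun x => f x ^+ 2)).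
Proof.
split=> [f2|[mf /integrableP[_ f2]]].
  by split; [exact: Lp_measurable f2|exact: Lfun2_integrable_sqr].
rewrite /Lp/= inE; apply/andP; split; rewrite inE//= /finite_norm.
rewrite unlock poweR_lty//; apply: le_lt_trans f2.
rewrite ge0_le_integral//=.
- apply/measurable_EFinP.
  apply: (@measurableT_comp _ _ _ _ _ _ (@powR R ^~ 2)) => //.
  exact: measurableT_comp.
- by apply/measurable_EFinP/measurableT_comp => //; exact: measurable_funX.
- by move=> x _; rewrite lee_fin powR_mulrn// normrX.
Qed.

Lemma Lp_lin p a f g : (1 <= p)%E -> Lp mu p f -> Lp mu p g ->
  Lp mu p (a *: f + g).
Proof. by move=> p1; have [_] := Lfun_submod_closed mu p1; apply. Qed.

Lemma Lp_cst0 p : (1 <= p)%E -> Lp mu p 0.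
Proof. by move=> p1; have [] := Lfun_submod_closed mu p1. Qed.

Lemma LpD p f g : (1 <= p)%E -> Lp mu p f -> Lp mu p g -> Lp mu p (f + g).
Proof. by move=> p1 fp gp; rewrite -[f]scale1r; exact: Lp_lin. Qed.

Lemma LpZ p a f : (1 <= p)%E -> Lp mu p f -> Lp mu p (a *: f).
Proof.
by move=> p1 fp; rewrite -[_ *: _]addr0; apply: Lp_lin => //; exact: Lp_cst0.
Qed.

Lemma LpN p f : (1 <= p)%E -> Lp mu p f -> Lp mu p (- f).
Proof. by move=> p1 fp; rewrite -scaleN1r; exact: LpZ. Qed.

Lemma LpB p f g : (1 <= p)%E -> Lp mu p f -> Lp mu p g -> Lp mu p (f - g).
Proof. by move=> p1 fp gp; apply: LpD => //; exact: LpN. Qed.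

Lemma Lp1_le f g : measurable_fun setT f -> (forall x, `|f x| <= `|g x|) ->
  Lp mu 1 g -> Lp mu 1 f.
Proof.
move=> mf fg /Lp1P gi; apply/Lp1P; apply: le_integrable gi => //.
- exact/measurable_EFinP.
- by move=> x _; rewrite lee_fin.
Qed.

Lemma Lp2_le f g : measurable_fun setT f -> (forall x, `|f x| <= `|g x|) ->
  Lp mu 2%:E g -> Lp mu 2%:E f.
Proof.
move=> mf fg /Lp2P[mg gi]; apply/Lp2P; split => //; apply: le_integrable gi => //.
- by apply/measurable_EFinP; exact: measurable_funX.
- by move=> x _; rewrite lee_fin !normrX lerXn2r ?nnegrE.
Qed.

Lemma Lp1_Lp2 f : Lp mu 1 f -> (forall x, `|f x| <= 1) -> Lp mu 2%:E f.
Proof.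
move=> f1 fle; apply/Lp2P; split; first exact: Lp_measurable f1.
have /Lp1P := f1; apply: le_integrable => //.
- apply/measurable_EFinP; apply: measurable_funX; exact: Lp_measurable f1.
- move=> x _; rewrite lee_fin normrX expr2.
  by rewrite -[leRHS]mulr1 ler_wpM2l.
Qed.

Lemma Lp_norm_ge0 p f : 0 <= Lp_norm mu p f.
Proof. by rewrite /Lp_norm fine_ge0// Lnorm_ge0. Qed.

Lemma Lp_norm1E f : Lp_norm mu 1 f = \int[mu]_x `|f x|.
Proof. by rewrite /Lp_norm Lnorm1. Qed.

Lemma Lp_norm2E f : Lp mu 2%:E f -> Lp_norm mu 2%:E f ^+ 2 = \int[mu]_x (f x ^+ 2).
Proof.
move=> f2; rewrite -powR_mulrn ?Lp_norm_ge0//.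
rewrite /Lp_norm -fine_poweR poweR_Lnorm// /Rintegral; congr fine.
apply: eq_integral => x _; rewrite poweR_EFin.
by rewrite powR_mulrn// real_normK// num_real.
Qed.

Lemma ler_Lp_normD p f g : (1 <= p)%E -> Lp mu p f -> Lp mu p g ->
  Lp_norm mu p (f + g) <= Lp_norm mu p f + Lp_norm mu p g.
Proof.
move=> p1 fp gp.
exact: (@ler_LnormD _ _ _ mu p p1 (Lfun_Sub p1 fp) (Lfun_Sub p1 gp)).
Qed.

Lemma Lp_normZ p a f : (1 <= p)%E -> Lp mu p f ->
  Lp_norm mu p (a *: f) = `|a| * Lp_norm mu p f.
Proof.
move=> p1 fp; rewrite /Lp_norm.
have /= -> := @LnormZ _ _ _ mu p p1 (Lfun_Sub p1 fp) a.
by rewrite fineM//; have /= <- := finite_norm_fine (Lfun_Sub p1 fp).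
Qed.

Lemma Lp_normN p f : Lp_norm mu p (- f) = Lp_norm mu p f.
Proof. by rewrite /Lp_norm; congr fine; exact: (oppe_Lnorm mu (EFin \o f)). Qed.

Lemma Lp_norm2_le f g : Lp mu 2%:E f -> Lp mu 2%:E g ->
  (\forall x \ae mu, `|f x| <= `|g x|) -> Lp_norm mu 2%:E f <= Lp_norm mu 2%:E g.
Proof.
move=> f2 g2 fg.
rewrite -(@ler_pXn2r _ 2)// ?nnegrE ?Lp_norm_ge0// !Lp_norm2E//.
have [mf fi] := (Lp2P f).1 f2; have [mg gi] := (Lp2P g).1 g2.
rewrite fine_le ?integrable_fin_num//.
apply: ae_ge0_le_integral => //.
- by move=> x _; rewrite lee_fin sqr_ge0.
- exact: measurable_int fi.
- by move=> x _; rewrite lee_fin sqr_ge0.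
- exact: measurable_int gi.
- apply: filterS fg => x fgx _.
  by rewrite lee_fin -real_normK ?num_real// -[leRHS]real_normK ?num_real// lerXn2r ?nnegrE.
Qed.

Lemma Lp_norm1_ae f g : Lp mu 1 f -> Lp mu 1 g -> f = g %[ae mu] ->
  Lp_norm mu 1 f = Lp_norm mu 1 g.
Proof.
move=> /Lp_measurable mf /Lp_measurable mg fg; rewrite !Lp_norm1E; congr fine.
apply: ae_eq_integral => //.
- by apply/measurable_EFinP; exact: measurableT_comp.
- by apply/measurable_EFinP; exact: measurableT_comp.
- by apply: filterS fg => x /(_ I) /= ->.
Qed.

Lemma Lp_norm2_eq0 f : Lp mu 2%:E f -> Lp_norm mu 2%:E f = 0 ->
  \forall x \ae mu, f x = 0.
Proof.
move=> f2 /(@fine_Lnormr_eq0 _ _ _ mu 2%:E (lee1n 2) (Lfun_Sub (lee1n 2) f2)).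
by apply: filterS => x /(_ I).
Qed.

Lemma ipE_integrable f w : Lp mu 2%:E f -> Lp mu 2%:E w ->
  mu.-integrable setT (EFin \o (f \* w)).
Proof. by move=> f2 w2; apply/Lp1P; exact: Lfun2_mul_Lfun1. Qed.

Lemma ip_le f w : Lp mu 2%:E f -> Lp mu 2%:E w ->
  \int[mu]_x `|f x * w x| <= Lp_norm mu 2%:E f * Lp_norm mu 2%:E w.
Proof.
move=> f2 w2.
have := @hoelder _ _ _ mu f w 2 2 (Lp_measurable f2) (Lp_measurable w2).
move=> /(_ ltac:(by []) ltac:(by []) ltac:(by rewrite [RHS]splitr !div1r)).
have f2' := @finite_norm_fine _ _ _ mu 2%:E (lee1n 2) (Lfun_Sub (lee1n 2) f2).
have w2' := @finite_norm_fine _ _ _ mu 2%:E (lee1n 2) (Lfun_Sub (lee1n 2) w2).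
rewrite -[in X in (_ <= X)%E -> _]f2' -[in X in (_ <= X)%E -> _]w2' -EFinM.
rewrite Lnorm1 /Rintegral => h.
rewrite -lee_fin fineK// ge0_fin_numE ?integral_ge0//.
by apply: le_lt_trans h _; rewrite ltry.
Qed.

(** One notion covers two pairings: with a square integrable function on L^2, and with a bounded
    measurable function on L^1. Vector-valued integrals are compared through their images under such
    functionals. *)
Definition bounded_functional (X : set (T -> R)) (nrm : (T -> R) -> R)
    (l : (T -> R) -> R) : Prop :=
  (forall a f g, X f -> X g -> l (a *: f + g) = a * l f + l g) /\
  exists2 C, 0 <= C & forall f, X f -> `|l f| <= C * nrm f.

Lemma bounded_functionalB X nrm l f g : bounded_functional X nrm l ->
  X f -> X g -> l (f - g) = l f - l g.
Proof.
by move=> [ll _] Xf Xg; rewrite addrC -scaleN1r ll// mulN1r addrC.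
Qed.

Lemma ip_functional2 w : Lp mu 2%:E w ->
  bounded_functional (Lp mu 2%:E) (Lp_norm mu 2%:E) (ip mu ^~ w).
Proof.
move=> w2; split=> [a f g f2 g2|].
  rewrite /ip -RintegralZl//; last exact: ipE_integrable.
  rewrite -RintegralD//; last exact: ipE_integrable.
    by apply: eq_Rintegral => x _ /=; rewrite mulrDl mulrA.
  apply: (integrableZl measurableT a (ipE_integrable f2 w2)).
exists (Lp_norm mu 2%:E w); first exact: Lp_norm_ge0.
move=> f f2; rewrite mulrC; apply: le_trans (ip_le f2 w2).
by apply: le_normr_Rintegral => //; exact: ipE_integrable.
Qed.

Lemma ip1_integrable f w : measurable_fun setT w -> (forall x, `|w x| <= 1) ->
  Lp mu 1 f -> mu.-integrable setT (EFin \o (f \* w)).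
Proof.
move=> mw w1 f1; have /Lp1P := f1; apply: le_integrable => //.
- apply/measurable_EFinP; apply: measurable_funM => //; exact: Lp_measurable f1.
- by move=> x _ /=; rewrite lee_fin normrM -[leRHS]mulr1 ler_wpM2l.
Qed.

Lemma ip_le1 f w : measurable_fun setT w -> (forall x, `|w x| <= 1) ->
  Lp mu 1 f -> `|ip mu f w| <= Lp_norm mu 1 f.
Proof.
move=> mw w1 f1; apply: le_trans (le_normr_Rintegral _ _) _ => //.
  exact: ip1_integrable.
rewrite Lp_norm1E; apply: le_Rintegral => //.
- exact: (integrable_norm (ip1_integrable mw w1 f1)).
- by apply: integrable_norm; exact/Lp1P.
- by move=> x _; rewrite normrM -[leRHS]mulr1 ler_wpM2l.
Qed.

Lemma ip_functional1 w : measurable_fun setT w -> (forall x, `|w x| <= 1) ->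
  bounded_functional (Lp mu 1) (Lp_norm mu 1) (ip mu ^~ w).
Proof.
move=> mw w1; split=> [a f g f1 g1|].
  rewrite /ip -RintegralZl//; last exact: ip1_integrable.
  rewrite -RintegralD//; last exact: ip1_integrable.
    by apply: eq_Rintegral => x _ /=; rewrite mulrDl mulrA.
  apply: (integrableZl measurableT a (ip1_integrable mw w1 f1)).
by exists 1 => // f f1; rewrite mul1r; exact: ip_le1.
Qed.

End Lp_basics.

(** * Bochner integrals *)

Lemma integrableD_EFin d (T : measurableType d) (R : realType)
    (mu : {measure set T -> \bar R}) (f g : T -> R) :
  mu.-integrable setT (EFin \o f) -> mu.-integrable setT (EFin \o g) ->
  mu.-integrable setT (EFin \o (fun x => f x + g x)).
Proof. exact: integrableD. Qed.

Lemma integrableZl_EFin d (T : measurableType d) (R : realType)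
    (mu : {measure set T -> \bar R}) a (f : T -> R) :
  mu.-integrable setT (EFin \o f) ->
  mu.-integrable setT (EFin \o (fun x => a * f x)).
Proof. exact: integrableZl. Qed.

Lemma integrable_indic_fin d (T : measurableType d) (R : realType)
    (mu : {measure set T -> \bar R}) (A : set T) :
  measurable A -> (mu A < +oo)%E ->
  mu.-integrable setT (fun x => (\1_A x)%:E).
Proof.
move=> mA A_fin; apply/integrableP; split; first exact/measurable_EFinP.
under eq_integral do rewrite /= ger0_norm//.
by rewrite integral_indic// setIT.
Qed.

Lemma integral_step d (T : measurableType d) (R : realType)
    (mu : {measure set T -> \bar R}) (A : nat -> set T) (c : nat -> R) n :
  (forall i, (i < n)%N -> measurable (A i) /\ (mu (A i) < +oo)%E) ->
  mu.-integrable setT (EFin \o (fun x => \sum_(i < n) \1_(A i) x * c i)) /\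
  \int[mu]_x (\sum_(i < n) \1_(A i) x * c i) =
    \sum_(i < n) fine (mu (A i)) * c i.
Proof.
elim: n => [|n IH] mA.
  under eq_Rintegral do rewrite big_ord0.
  under [X in EFin \o X]eq_fun do rewrite big_ord0.
  by rewrite big_ord0 Rintegral_cst// mul0r; split => //; exact/Lp1P/Lp_cst0.
have [|iS eS] := IH; first by move=> i /ltnW; exact: mA.
have [mAn An_fin] := mA n (ltnSn n).
have i1 := integrable_indic_fin mAn An_fin.
have iA : mu.-integrable setT (EFin \o (fun x => \1_(A n) x * c n)).
  by have := integrableZr measurableT (c n) i1.
under eq_Rintegral do rewrite big_ord_recr.
under [X in EFin \o X]eq_fun do rewrite big_ord_recr.
split; first exact: integrableD_EFin.
rewrite big_ord_recr RintegralD// eS; congr (_ + _).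
by rewrite RintegralZr// /Rintegral integral_indic// setIT.
Qed.

(** * Scalar integrals obtained by testing Bochner integrals *)

Section integral_approx.
Context (R : realType).
Local Notation leb := (@lebesgue_measure R).

(* c is the integral of phi, which need not be measurable: when F is Bochner
   integrable and l is a bounded functional, l (F t) is only known to be close
   to step functions. *)
Definition integral_approx (phi : R -> R) (c : R) : Prop :=
  forall e : R, 0 < e -> exists a r : R -> R,
    [/\ leb.-integrable setT (EFin \o a), leb.-integrable setT (EFin \o r),
        forall t, `|phi t - a t| <= r t,
        \int[leb]_t r t <= e & `|\int[leb]_t a t - c| <= e].

(** Only the approximants are integrated: [a1 <= a2 + r1 + r2] pointwise, and each of the four
    errors, two from the [r] and two from the integrals of the [a], costs e / 4. *)
Lemma integral_approx_le phi1 c1 phi2 c2 :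
  integral_approx phi1 c1 -> integral_approx phi2 c2 ->
  (forall t, phi1 t <= phi2 t) -> c1 <= c2.
Proof.
move=> h1 h2 le12; apply/ler_addgt0Pr => e e0.
have e4 : 0 < e / 4 by rewrite divr_gt0.
have [a1 [r1 [ia1 ir1 d1 s1 n1]]] := h1 _ e4.
have [a2 [r2 [ia2 ir2 d2 s2 n2]]] := h2 _ e4.
have : \int[leb]_t a1 t <= \int[leb]_t (a2 t + (r1 t + r2 t)).
  apply: le_Rintegral => //.
    by do 2 apply: integrableD_EFin => //.
  move=> t _; have := d1 t; have := d2 t; have := le12 t.
  by rewrite !ler_norml => ? /andP[? ?] /andP[? ?]; lra.
rewrite RintegralD//; last exact: integrableD_EFin.
rewrite RintegralD//.
move: n1 n2; rewrite !ler_norml => /andP[? ?] /andP[? ?]; lra.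
Qed.

Lemma integral_approxD phi1 c1 phi2 c2 :
  integral_approx phi1 c1 -> integral_approx phi2 c2 ->
  integral_approx (phi1 \+ phi2) (c1 + c2).
Proof.
move=> h1 h2 e e0; have e2 : 0 < e / 2 by rewrite divr_gt0.
have [a1 [r1 [ia1 ir1 d1 s1 n1]]] := h1 _ e2.
have [a2 [r2 [ia2 ir2 d2 s2 n2]]] := h2 _ e2.
exists (a1 \+ a2), (r1 \+ r2); split.
- exact: integrableD_EFin.
- exact: integrableD_EFin.
- move=> t /=; have := d1 t; have := d2 t.
  by rewrite !ler_norml => /andP[? ?] /andP[? ?]; lra.
- by rewrite RintegralD//; lra.
- rewrite RintegralD//; move: n1 n2.
  by rewrite !ler_norml => /andP[? ?] /andP[? ?]; lra.
Qed.

Lemma integral_approx_integrable (phi : R -> R) :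
  leb.-integrable setT (EFin \o phi) ->
  integral_approx phi (\int[leb]_t phi t).
Proof.
move=> iphi e e0; exists phi, (cst 0); split => //.
- exact/Lp1P/Lp_cst0.
- by move=> t; rewrite subrr normr0.
- by rewrite Rintegral_cst// mul0r ltW.
- by rewrite subrr normr0 ltW.
Qed.

End integral_approx.

Section bochner.
Context d (T : measurableType d) (R : realType).
Variables (X : set (T -> R)) (nrm : (T -> R) -> R).
Hypothesis X0 : X 0.
Hypothesis Xlin : forall a f g, X f -> X g -> X (a *: f + g).
Hypothesis nrm_ge0 : forall f, 0 <= nrm f.
Local Notation leb := (@lebesgue_measure R).

Lemma bounded_functional_sum l n (a : nat -> R) (x : nat -> T -> R) :
  bounded_functional X nrm l -> (forall i, (i < n)%N -> X (x i)) ->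
  X (\sum_(i < n) a i *: x i) /\
  l (\sum_(i < n) a i *: x i) = \sum_(i < n) a i * l (x i).
Proof.
move=> [llin _]; elim: n => [|n IH] Xx.
  rewrite !big_ord0; split => //.
  by have := llin (-1) 0 0 X0 X0; rewrite scaler0 addr0 mulN1r addNr.
have [|IHX IHl] := IH; first by move=> i /ltnW; exact: Xx.
rewrite !big_ord_recr/= addrC; split; first by apply: Xlin => //; exact: Xx.
by rewrite llin//; [rewrite IHl addrC|exact: Xx].
Qed.

(** [l] maps an approximating simple function s to a scalar step function, and [|l (F t) - l (s t)|]
    is at most [C * nrm (F t - s t)], whose integral tends to 0. The last clause of
    [is_bochner_integral] identifies the limit of the integrals of the step functions as [l h]. *)
Lemma bochner_integral_approx (I : set R) (F : R -> T -> R) h l : measurable I ->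
  bounded_functional X nrm l -> (forall t, I t -> X (F t)) ->
  is_bochner_integral X nrm I F h ->
  integral_approx ((l \o F) \_ I) (l h).
Proof.
move=> mI lX XF [Xh [n [A [x /= [Ax ms _ ints cvgh]]]]] e e0.
have [llin [C C0 lC]] := lX.
(* [C + 1] can be divided by even when [C] vanishes. *)
have C1 : 0 < C + 1 by lra.
have eC : 0 < e / (C + 1) by rewrite divr_gt0.
have /= h1 : \forall k \near \oo, (\int[leb]_(t in I)
     (nrm (F t - \sum_(i < n k) \1_(A k i) t *: x k i))%:E < (e / (C + 1))%:E)%E.
  by apply: (ints [set y | (y < (e / (C + 1))%:E)%E]); apply: open_ereal_lt'; rewrite lte_fin.
have /cvgr_distC_lt : nrm (\sum_(i < n k) fine (leb (A k i)) *: x k i - h)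
   @[k --> \oo] --> (0 : R) by [].
move=> /(_ _ eC) h2.
near \oo => k.
have h1k : (\int[leb]_(t in I)
     (nrm (F t - \sum_(i < n k) \1_(A k i) t *: x k i))%:E < (e / (C + 1))%:E)%E.
  by near: k; exact: h1.
have h2k : `|nrm (\sum_(i < n k) fine (leb (A k i)) *: x k i - h) - 0| < e / (C + 1).
  by near: k; exact: h2.
have Axk i : (i < n k)%N -> X (x k i) by move=> /(Ax k) [].
have Ak i : (i < n k)%N -> measurable (A k i) /\ (leb (A k i) < +oo)%E.
  by move=> /(Ax k) [].
pose s t := \sum_(i < n k) \1_(A k i) t *: x k i.
have ints_k : leb.-integrable I (EFin \o (fun t => nrm (F t - s t))).
  apply/integrableP; split; first by apply/measurable_EFinP; exact: (ms k).
  under eq_integral do rewrite /= ger0_norm//.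
  by apply: lt_trans h1k _; rewrite ltry.
have XB f g : X f -> X g -> X (f - g).
  by move=> Xf Xg; rewrite addrC -scaleN1r; exact: Xlin.
have lB f g : X f -> X g -> l (f - g) = l f - l g.
  exact: bounded_functionalB lX.
exists (fun t => \sum_(i < n k) \1_(A k i) t * l (x k i)),
  (fun t => C * ((fun t => nrm (F t - s t)) \_ I) t); split.
- exact: (@integral_step _ _ _ leb _ (fun i => l (x k i)) _ Ak).1. 
- apply: integrableZl_EFin.
  by move/integrable_mkcond : ints_k; rewrite restrict_EFin; apply.
- move=> t; rewrite !patchE; case: ifPn => [/set_mem It|/negP nIt].
    have [Xs ls] := bounded_functional_sum (fun i => \1_(A k i) t) lX Axk.
    by rewrite /= -ls -lB//; [exact/lC/XB/Xs/XF|exact: XF].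
  (* Outside [I] the step function vanishes as well, since its sets [A k i] lie in [I]. *)
  rewrite big1 ?subrr ?normr0 ?mulr0// => i _.
  rewrite indicE memNset ?mul0r// => At; apply: nIt; apply/mem_set.
  by have [_ + _ _] := Ax k _ (ltn_ord i); apply.
- rewrite RintegralZl//; last first.
    by move/integrable_mkcond : ints_k; rewrite restrict_EFin; apply.
  rewrite -Rintegral_mkcond -/(s _).
  have : \int[leb]_(t in I) nrm (F t - s t) <= e / (C + 1).
    rewrite -lee_fin /Rintegral fineK; first exact: ltW.
    exact: integrable_fin_num.
  move=> /(ler_wpM2l C0)/le_trans; apply.
  rewrite mulrCA -[leRHS]mulr1 ler_pM2l// ler_pdivrMr//; lra.
- have ls := bounded_functional_sum (fun i => fine (leb (A k i))) lX Axk.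
  rewrite (_ : Rintegral _ _ _ = \sum_(i < n k) fine (leb (A k i)) * l (x k i)).
    rewrite -ls.2 -lB//; last exact: ls.1.
    apply: le_trans (lC _ (XB _ _ ls.1 Xh)) _.
    move: h2k; rewrite subr0 ger0_norm// => /ltW /(ler_wpM2l C0)/le_trans; apply.
    rewrite mulrCA -[leRHS]mulr1 ler_pM2l// ler_pdivrMr//; lra.
  exact: (@integral_step _ _ _ leb _ (fun i => l (x k i)) _ Ak).2.
Unshelve. all: by end_near. Qed.

End bochner.

(** * Completeness of L^1 along fast Cauchy sequences *)

(** The telescoping series converges absolutely, and [|a n - a k|] for k >= n is at most a part of
    the total variation; hence the bound [M] holds for every n. In the completeness proof this lets
    one function dominate all the differences. *)
Lemma bounded_variation_cvgn (R : realType) (a : nat -> R) (M : R) :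
  (forall n, \sum_(0 <= k < n) `|a k.+1 - a k| <= M) ->
  a @ \oo --> limn a /\ forall n, `|a n - limn a| <= M.
Proof.
move=> aM.
have cva : cvgn a.
  have nd : nondecreasing_seq (series (fun k => `|a k.+1 - a k|)).
    by apply/nondecreasing_seqP => n; rewrite seriesSr lerDl.
  have /(nondecreasing_is_cvgn nd) : has_ubound (range (series (fun k => `|a k.+1 - a k|))).
    by exists M => _ [n _ <-]; rewrite seriesEnat/=.
  move=> /(@normed_cvg R R^o (telescope a)); rewrite telescopeK => cv.
  have -> : a = (fun n => (a n - a 0%N) + a 0%N).
    by apply/funext => n; rewrite subrK.
  by apply: is_cvgD => //; exact: is_cvg_cst.
split => // n.
have cvd : `|a n - a k| @[k --> \oo] --> `|a n - limn a|.
  by apply: cvg_norm; apply: cvgB => //; exact: cvg_cst.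
rewrite -(cvg_lim _ cvd)//; apply: limr_le; first by apply/cvg_ex; eexists; exact: cvd.
near=> k; have nk : (n <= k)%N by near: k; exact: nbhs_infty_ge.
rewrite distrC -(telescope_sumr _ nk); apply: le_trans (ler_norm_sum _ _ _) _.
apply: le_trans (aM k); rewrite [leRHS](big_cat_nat (n := n))//= lerDr.
by apply: sumr_ge0.
Unshelve. all: by end_near. Qed.

Section L1_complete.
Context d (T : measurableType d) (R : realType).
Variable mu : {measure set T -> \bar R}.

(** Riesz-Fischer argument: [D], the pointwise variation of the sequence, has integral at most 2 C
    by the geometric series, so it is finite a.e. and dominates every [|r n - h|]; dominated
    convergence gives convergence in norm. *)
Lemma Lp1_complete (C : R) (r : nat -> T -> R) : (forall n, Lp mu 1 (r n)) ->
  (forall n, Lp_norm mu 1 (r n.+1 - r n) <= C / 2 ^+ n) ->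
  exists2 h, Lp mu 1 h & Lp_norm mu 1 (r n - h) @[n --> \oo] --> (0 : R).
Proof.
move=> r1 rC.
pose dd n x := (`|r n.+1 x - r n x|)%:E.
pose D x := (\sum_(0 <= k <oo) dd k x)%E.
have rB m n : Lp mu 1 (r m - r n) by exact: LpB.
have mdd n : measurable_fun setT (dd n).
  by apply/measurable_EFinP/measurableT_comp => //; exact: (Lp_measurable (rB n.+1 n)).
have mD : measurable_fun setT D by apply: (@ge0_emeasurable_sum _ _ _ setT dd xpredT) => // k x _ _; rewrite lee_fin.
have D0 x : (0 <= D x)%E by apply: nneseries_ge0 => *; rewrite lee_fin.
have iD : mu.-integrable setT D.
  apply/integrableP; split => //.
  under eq_integral do rewrite gee0_abs//.
  rewrite integral_nneseries//; last by move=> n x _; rewrite lee_fin.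
  have C0 : 0 <= C by have := rC 0%N; rewrite expr0 divr1; apply: le_trans; exact: Lp_norm_ge0.
  apply: (@le_lt_trans _ _ (\sum_(0 <= k <oo) (C / 2 ^+ k)%:E)%E).
    apply: lee_nneseries => [n _ _|n _].
    - by apply: integral_ge0 => x _; rewrite lee_fin.
    - rewrite -(@fineK _ (integral _ _ _)); last first.
        apply: integrable_fin_num => //; apply: integrable_norm.
        by apply/Lp1P; exact: (rB n.+1 n).
      by rewrite lee_fin; have := rC n; rewrite Lp_norm1E.
  apply: (@le_lt_trans _ _ (C * (1 - 2^-1)^-1)%:E); last exact: ltry.
  apply: lime_le.
    by apply: is_cvg_nneseries => n _ _; rewrite lee_fin divr_ge0// exprn_ge0.
  near=> n; rewrite sumEFin lee_fin.
  have := @geometric_le_lim R n C 2^-1 C0; rewrite invr_gt0 ger0_norm// invf_lt1//.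
  move=> /(_ ltac:(lra) ltac:(lra)); rewrite /series/=.
  by under eq_bigr do rewrite exprVn.
have Dfin : \forall x \ae mu, forall n, \sum_(0 <= k < n) `|r k.+1 x - r k x| <= fine (D x).
  have := integrable_ae measurableT iD; apply: filterS => x /(_ I) Dx n.
  rewrite -lee_fin fineK// -sumEFin; exact: nneseries_lim_ge.
(* The upper limit is measurable without any convergence assumption, and [fine] makes it real also
   on the null set where the sequence may diverge. *)
pose h x := fine (limn_esup (fun n => (r n x)%:E)).
have mh : measurable_fun setT h.
  apply: measurableT_comp => //; apply: measurable_fun_limn_esup => n.
  by apply/measurable_EFinP; exact: Lp_measurable (r1 n).
have rh : \forall x \ae mu, r n x @[n --> \oo] --> h x /\ forall n, `|r n x - h x| <= fine (D x).
  apply: filterS Dfin => x /bounded_variation_cvgn[cv le].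
  suff -> : h x = limn (r ^~ x) by [].
  have cvE : (r n x)%:E @[n --> \oo] --> (limn (r ^~ x))%:E.
    by apply: cvg_EFin; [exact: nearW|exact: cv].
  by rewrite /h (cvg_limn_einf_sup cvE).2.
have mrh n : measurable_fun setT (fun x => `|r n x - h x|).
  apply: measurableT_comp => //; apply: measurable_funB => //.
  exact: Lp_measurable (r1 n).
have rhD : \forall x \ae mu, forall n, (`|r n x - h x|%:E <= D x)%E.
  apply: filterS2 (integrable_ae measurableT iD) rh => x /(_ I) Dx [_ le] n.
  by rewrite -(fineK Dx) lee_fin.
have mrhE n : measurable_fun setT (fun x => (`|r n x - h x|)%:E).
  exact/measurable_EFinP.
have r0h : Lp mu 1 (r 0%N - h).
  apply/Lp1P/integrableP; split.
    by apply/measurable_EFinP; apply: measurable_funB => //; exact: Lp_measurable (r1 0%N).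
  apply: le_lt_trans (integrable_lty measurableT iD).
  apply: ae_ge0_le_integral => //; first exact: (mrhE 0%N).
  by apply: filterS rhD => x /(_ 0%N).
exists h.
  by rewrite -[h](subKr (r 0%N)); exact: LpB.
have := @dominated_convergence _ _ _ mu setT measurableT
  (fun n x => (`|r n x - h x|)%:E) (cst 0%E) D mrhE (measurable_cst _) _ iD _.
move=> []; [| |move=> _ _].
- apply: filterS rh => x [cv _] _; apply: cvg_EFin; first exact: nearW.
  rewrite -[X in _ --> X](normr0 R) -(subrr (h x)).
  by apply: cvg_norm; apply: cvgB => //; exact: cvg_cst.
- by apply: filterS rhD => x le n _; rewrite gee0_abs ?lee_fin.
rewrite integral_cst// mul0e => /fine_cvg.
by under [X in _ -> X @ _ --> _]eq_fun do rewrite Lp_norm1E.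
Unshelve. all: by end_near. Qed.

End L1_complete.

(** * Riemann sums of L^1-valued functions *)

Section riemann.
Context (R : realType).
Local Notation leb := (@lebesgue_measure R).

(** The condition is multiplied through by [m], so that the index of the cell containing t is the
    integer part of t * m. *)
Definition cell (N m i : nat) : set R :=
  `]0, N%:R[ `&` [set t | i%:R <= t * m%:R < i.+1%:R].

Lemma measurable_cell N m i : measurable (cell N m i).
Proof.
apply: measurableI => //.
have mM : measurable_fun setT (fun t : R => t * m%:R) by apply: measurable_funM.
have -> : [set t : R | i%:R <= t * m%:R < i.+1%:R] =
  setT `&` (fun t => t * m%:R) @^-1` `[i%:R, i.+1%:R[.
  by rewrite setTI; apply/seteqP; split => t /=; rewrite in_itv.
by apply: mM => //; exact: measurable_itv.
Qed.

(** The point [i.+1 / m] is the right end of the cell of t. The collapse of the sum is stated in any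
    module because it serves both function-valued and real sums. *)
Lemma cell_sum N m t : (0 < m)%N ->
  `]0, N%:R[%classic t -> exists i : nat,
  [/\ (i < N * m)%N, t <= i.+1%:R / m%:R, i.+1%:R / m%:R - t <= m%:R^-1 &
      forall (V : lmodType R) (f : nat -> V),
        \sum_(j < N * m) \1_(cell N m j) t *: f j = f i].
Proof.
move=> m0 /[dup] It; rewrite /= in_itv/= => /andP[t0 tN].
have mR : 0 < m%:R :> R by rewrite ltr0n.
have tm0 : 0 <= t * m%:R by rewrite mulr_ge0// ltW.
have /andP[i1 i2] := truncn_itv tm0.
have iNm : (Num.truncn (t * m%:R) < N * m)%N.
  by rewrite -(ltr_nat R) natrM; apply: le_lt_trans i1 _; rewrite ltr_pM2r.
exists (Num.truncn (t * m%:R)); split => //.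
- by rewrite ler_pdivlMr// ltW.
- rewrite lerBlDr ler_pdivrMr// mulrDl mulVf ?gt_eqF//.
  by rewrite -natr1 addrC lerD2l.
move=> V f; rewrite (bigD1 (Ordinal iNm))//= big1 ?addr0.
  by rewrite indicE mem_set ?scale1r//; split => //=; rewrite i1 i2.
move=> j; rewrite -val_eqE/= => ij; rewrite indicE memNset ?scale0r//.
by move=> [_ /= /truncn_def e]; rewrite e eqxx in ij.
Qed.

Lemma lebesgue_measure_oo N : leb `]0, N%:R[ = N%:R%:E :> \bar R.
Proof.
rewrite lebesgue_measure_itv/= lte_fin ltr0n; case: N => [|N] //=.
by rewrite sube0.
Qed.

Lemma lebesgue_measure_cell N m i : (leb (cell N m i) < +oo)%E.
Proof.
apply: (@le_lt_trans _ _ (leb `]0, N%:R[)); last by rewrite lebesgue_measure_oo ltry.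
by apply: le_measure; rewrite ?inE//; [exact: measurable_cell|exact: subIsetl].
Qed.

Context d (T : measurableType d) (mu : {measure set T -> \bar R}).
Local Notation L1 := (Lp mu 1).
Local Notation nrm := (Lp_norm mu 1).

(** Pairing with the sign of f, set to 1 at the zeros, recovers the L^1 norm. Sums over two
    different meshes thus become scalar step functions, which are compared without a common
    refinement. *)
Lemma sign_functional (f : T -> R) : L1 f -> exists2 w : T -> R,
  measurable_fun setT w /\ (forall x, `|w x| <= 1) & ip mu f w = nrm f.
Proof.
move=> f1; exists (fun x => if 0 <= f x then 1 else -1).
  split; last by move=> x; case: ifPn; rewrite ?normrN normr1.
  apply: measurable_fun_ifT => //.
  by apply: measurable_fun_ler => //; exact: Lp_measurable f1.
rewrite Lp_norm1E; apply: eq_Rintegral => x _; case: ifPn => f0.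
  by rewrite mulr1 ger0_norm.
by rewrite mulrN1 ltr0_norm// ltNge.
Qed.

(* The Riemann sums r k of mesh 1 / m k form a Cauchy sequence: the norm of
   r k.+1 - r k is attained by a functional, hence is the integral of a scalar
   step function bounded by 2 / 2 ^+ k. *)
Lemma bochner_integral_exists (F : R -> T -> R) (N : nat) :
  (forall t, 0 < t -> L1 (F t)) ->
  (forall e : R, 0 < e -> exists2 dl : R, 0 < dl & forall s t,
     0 < s -> s <= t -> t - s <= dl -> nrm (F t - F s) <= e) ->
  exists h, is_bochner_integral L1 nrm `]0, N%:R[ F h.
Proof.
move=> F1 Fuc.
have /choice[m mP] : forall k : nat, exists m : nat, (0 < m)%N /\
    forall s t, 0 < s -> s <= t -> t - s <= m%:R^-1 -> nrm (F t - F s) <= 2^-1 ^+ k.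
  move=> k; have k0 : 0 < 2^-1 ^+ k :> R by rewrite exprn_gt0// invr_gt0.
  have [dl dl0 H] := Fuc _ k0.
  exists (Num.truncn dl^-1).+1; split => // s t s0 st ts; apply: H => //.
  apply: le_trans ts _; rewrite invf_ple ?posrE//.
  by rewrite ltW// truncnS_gt.
have m0 k : (0 < m k)%N := (mP k).1.
have mR k : 0 < (m k)%:R :> R by rewrite ltr0n.
(* The tag is the right end of the cell, which is positive also for i = 0; [F] is controlled at
   positive times only. *)
pose x k i := F (i.+1%:R / (m k)%:R).
have x1 k i : L1 (x k i) by apply: F1; rewrite divr_gt0// ltr0n.
pose s k t := \sum_(i < N * m k) \1_(cell N (m k) i) t *: x k i.
have FB t t' : 0 < t -> 0 < t' -> L1 (F t - F t') by move=> *; apply: LpB => //; exact: F1.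
have sP k t : `]0, N%:R[%classic t -> nrm (F t - s k t) <= 2^-1 ^+ k.
  move=> /[dup] It; rewrite /= in_itv/= => /andP[t0 tN].
  have [i [_ i1 i2 e]] := cell_sum (m0 k) It; rewrite /s e.
  by rewrite -Lp_normN opprB; exact: (mP k).2.
pose r k := \sum_(i < N * m k) fine (leb (cell N (m k) i)) *: x k i.
have p1 : (1 <= 1 :> \bar R)%E by [].
have functional_sum l k (a : nat -> R) : bounded_functional L1 nrm l ->
    L1 (\sum_(i < N * m k) a i *: x k i) /\
    l (\sum_(i < N * m k) a i *: x k i) = \sum_(i < N * m k) a i * l (x k i).
  move=> lP; apply: (@bounded_functional_sum _ _ _ L1 nrm) => //.
  - exact: Lp_cst0.
  - by move=> *; exact: Lp_lin.
have r1 k : L1 (r k).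
  (* The zero functional serves only to extract membership in L^1. *)
  apply: (functional_sum (ip mu ^~ (cst 0 : T -> R)) k (fun i => fine (leb (cell N (m k) i))) _).1.
  by apply: ip_functional1 => // y; rewrite normr0.
(* On []0, N[] the two step functions are within 2^-k and 2^-(k+1) of the image of [F] under the
   functional, hence within 2 / 2^k of each other; the interval has length N. *)
have rC k : nrm (r k.+1 - r k) <= (N%:R * 2) / 2 ^+ k.
  have rB : L1 (r k.+1 - r k) by exact: LpB.
  have [w [mw w1] <-] := sign_functional rB.
  have lP := ip_functional1 mu mw w1.
  set l := ip mu ^~ w in lP; rewrite -/(l _).
  pose a j t := \sum_(i < N * m j) \1_(cell N (m j) i) t * l (x j i).
  have cellP j i : (i < N * m j)%N ->
      measurable (cell N (m j) i) /\ (leb (cell N (m j) i) < +oo)%E.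
    by move=> _; split; [exact: measurable_cell|exact: lebesgue_measure_cell].
  have aP j := @integral_step _ _ _ leb _ (fun i => l (x j i)) _ (cellP j).
  have lr j : l (r j) = \int[leb]_t a j t.
    rewrite (aP j).2.
    exact: (functional_sum l j (fun i => fine (leb (cell N (m j) i))) lP).2.
  have al t j : `]0, N%:R[%classic t -> `|l (F t) - a j t| <= 2^-1 ^+ j.
    move=> /[dup] It; rewrite /= in_itv/= => /andP[t0 tN].
    have Ft := F1 _ t0.
    have [s1 ls] := functional_sum l j (fun i => \1_(cell N (m j) i) t) lP.
    rewrite /a -ls; apply: le_trans (sP _ _ It).
    rewrite -(bounded_functionalB lP)//.
    by apply: ip_le1 => //; exact: LpB.
  have a0 t j : ~ `]0, N%:R[%classic t -> a j t = 0.
    move=> nIt; rewrite /a big1// => i _.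
    by rewrite indicE memNset ?mul0r// => -[].
  rewrite (bounded_functionalB lP)// !lr -RintegralB//; [|exact: (aP _).1..].
  have iI : leb.-integrable setT (fun t => (\1_(`]0, N%:R[%classic : set R) t)%:E).
    apply: (@integrable_indic_fin _ _ _ leb) => //.
    by move: (lebesgue_measure_oo N) => /= ->; rewrite ltry.
  apply: (@le_trans _ _ (\int[leb]_t (2 / 2 ^+ k * \1_(`]0, N%:R[%classic : set R) t))).
    apply: le_Rintegral => //.
    - by have := integrableB measurableT (aP k.+1).1 (aP k).1.
    - exact: integrableZl_EFin.
    move=> t _; rewrite indicE; case: (boolP (t \in _)) => [/set_mem It|/negP nIt].
      rewrite mulr1; have := al _ k It; have := al _ k.+1 It.
      rewrite exprS !ler_norml exprVn.
      have : 0 < (2 ^+ k)^-1 :> R by rewrite invr_gt0 exprn_gt0.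
      by move=> ? /andP[? ?] /andP[? ?]; lra.
    by rewrite !a0 ?mulr0 ?subrr// => It; apply: nIt; exact/mem_set.
  rewrite RintegralZl// /Rintegral integral_indic// setIT.
  rewrite (_ : fine _ = N%:R); first by rewrite mulrC mulrA.
  by move: (lebesgue_measure_oo N) => /= ->.
have [h h1 rh] := Lp1_complete r1 rC.
(* On a cell [s k] is constant and [t |-> nrm (F t - x k i)] is continuous, by the uniform
   continuity of [F]; the indicators of the cells glue these functions together. *)
have ms k : measurable_fun (`]0, N%:R[%classic : set R) (fun t => nrm (F t - s k t)).
  have Fx i : measurable_fun (`]0, N%:R[%classic : set R) (fun t => nrm (F t - x k i)).
    apply: open_continuous_measurable_fun; first exact: interval_open.
    move=> t; rewrite inE/= in_itv/= => /andP[t0 tN].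
    apply/cvgrPdist_le => e e0; have [dl dl0 H] := Fuc _ e0.
    near=> u.
    have u0 : 0 < u by near: u; exact: lt_nbhsr.
    have tu : `|t - u| <= dl.
      by near: u; exact: (@cvgr_dist_le _ _ _ _ _ id t cvg_id dl dl0).
    have tri v w : 0 < v -> 0 < w -> nrm (F v - F w) <= e ->
        nrm (F v - x k i) <= e + nrm (F w - x k i).
      move=> v0 w0 vw; apply: le_trans (lerD vw (lexx _)).
      rewrite -[F v - x k i](subrKA (F w)); apply: ler_Lp_normD => //.
        exact: FB.
      by apply: LpB => //; exact: F1.
    have [vw wv] : nrm (F t - F u) <= e /\ nrm (F u - F t) <= e.
      have [le_tu|/ltW le_ut] := leP t u.
        rewrite -[X in X <= _]Lp_normN opprB; split; apply: H => //;
        by rewrite (le_trans (ler_norm _))// distrC.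
      rewrite -[X in _ /\ X <= _]Lp_normN opprB; split; apply: H => //;
      by rewrite (le_trans (ler_norm _)).
    rewrite ler_norml; have := tri _ _ t0 u0 vw; have := tri _ _ u0 t0 wv; lra.
  apply: (@eq_measurable_fun _ _ _ _ _
      (fun t => \sum_(i < N * m k) \1_(cell N (m k) i) t * nrm (F t - x k i))).
    move=> t /set_mem It; have [i [_ _ _ e]] := cell_sum (m0 k) It.
    by rewrite /s e; exact: (e R^o (fun i => nrm (F t - x k i))).
  apply: measurable_sum => i; apply: measurable_funM => //.
  apply: measurable_funTS; apply: measurable_indic; exact: measurable_cell.
have half0 : (fun k => 2^-1 ^+ k) @ \oo --> (0 : R).
  by apply: cvg_expr; rewrite ger0_norm// invf_lt1// ltr1n.
have N0 : (fun k => (2^-1 ^+ k * N%:R)%:E) @ \oo --> (0 : \bar R)%E.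
  apply: cvg_EFin; first exact: nearW.
  by rewrite -[X in _ --> X](mul0r N%:R); apply: cvgMl.
exists h; split => //; exists (fun k => N * m k)%N, (fun k => cell N (m k)), x.
split => /=.
- move=> k i _; split => //; [exact: measurable_cell|exact: subIsetl|].
  exact: lebesgue_measure_cell.
- exact: ms.
- apply/aeW => t It; apply: squeeze_cvgr (cvg_cst (0 : R)) half0.
  by apply: nearW => k; rewrite Lp_norm_ge0 sP.
- apply: (squeeze_cvge _ (cvg_cst 0%E) N0); apply: nearW => k.
  rewrite integral_ge0 => [/=|t _]; last by rewrite lee_fin Lp_norm_ge0.
  rewrite EFinM -lebesgue_measure_oo -integral_cst//.
  apply: ge0_le_integral => //.
  + by move=> t _; rewrite lee_fin Lp_norm_ge0.
  + by apply/measurable_EFinP; exact: ms.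
  + by move=> t It; rewrite lee_fin; exact: sP.
- exact: rh.
Unshelve. all: by end_near. Qed.

End riemann.

(** * From L^2 continuity to L^1 continuity *)

Section L1_continuity.
Context d (T : measurableType d) (R : realType).
Variable mu : {measure set T -> \bar R}.
Local Notation L1 := (Lp mu 1).
Local Notation L2 := (Lp mu 2%:E).
Local Notation nrm1 := (Lp_norm mu 1).
Local Notation nrm2 := (Lp_norm mu 2%:E).

Lemma ae_le_Rintegral (f g : T -> R) : mu.-integrable setT (EFin \o f) ->
  mu.-integrable setT (EFin \o g) -> (\forall x \ae mu, f x <= g x) ->
  \int[mu]_x f x <= \int[mu]_x g x.
Proof.
move=> fi gi fg; rewrite -subr_ge0 -RintegralB//.
have mgf : measurable_fun setT (fun x => g x - f x).
  by apply: measurable_funB; apply/measurable_EFinP; exact: (measurable_int mu).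
rewrite /Rintegral (@ae_eq_integral _ _ _ mu setT (fun x => (`|g x - f x|)%:E))//.
- exact: (@Rintegral_ge0 _ _ _ _ _ (fun x => `|g x - f x|)).
- exact/measurable_EFinP.
- by apply/measurable_EFinP; exact: measurableT_comp.
- by apply: filterS fg => x fgx _ /=; rewrite ger0_norm// subr_ge0.
Qed.

(* |v - g| = (v - g) + 2 (g - v)^+, where v - g has nonpositive integral and
   (g - v)^+ <= min(g, dl) + (g / dl) |v - g|. *)
Lemma L1_dist_le (g v : T -> R) (dl : R) : 0 < dl -> L1 g -> L2 g -> L1 v -> L2 v ->
  (forall x, 0 <= g x) -> (\forall x \ae mu, 0 <= v x) -> nrm1 v <= nrm1 g ->
  nrm1 (v - g) <= 2 * \int[mu]_x Num.min (g x) dl + 2 / dl * (nrm2 g * nrm2 (v - g)).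
Proof.
move=> dl0 g1 g2 v1 v2 g0 v0 vg.
have p1 : (1 <= 1 :> \bar R)%E by [].
have p2 : (1 <= 2%:E :> \bar R)%E by exact: lee1n.
have vg1 : L1 (v - g) by exact: LpB.
have vg2 : L2 (v - g) by exact: LpB.
have mg := Lp_measurable g1.
have min1 : L1 (fun x => Num.min (g x) dl).
  apply: Lp1_le g1; first exact: measurable_minr.
  move=> x; have m0 : 0 <= Num.min (g x) dl by rewrite le_min g0 ltW.
  by rewrite (ger0_norm m0) ger0_norm// ge_min lexx.
have igvg : mu.-integrable setT (EFin \o (fun x => `|g x * (v x - g x)|)).
  by apply: integrable_norm; exact: (ipE_integrable g2 vg2).
have ipl : \int[mu]_x `|g x * (v x - g x)| <= nrm2 g * nrm2 (v - g) := ip_le g2 vg2.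
have int_vg : \int[mu]_x (v x - g x) <= 0.
  rewrite RintegralB//; [|exact/Lp1P..].
  rewrite subr_le0; move: vg; rewrite !Lp_norm1E.
  under [leRHS]eq_Rintegral do rewrite ger0_norm//.
  apply: le_trans; apply: le_Rintegral => //; first exact/Lp1P.
    by apply: integrable_norm; exact/Lp1P.
  by move=> x _; exact: ler_norm.
have /Lp1P im := min1.
have i1 := integrableZl_EFin 2 im.
have i2 := integrableZl_EFin (2 / dl) igvg.
have i3 : mu.-integrable setT (EFin \o (fun x => v x - g x)) by exact/Lp1P.
have i12 := integrableD_EFin i1 i2.
have i123 := integrableD_EFin i3 i12.
have : nrm1 (v - g) <= \int[mu]_x ((v x - g x) +
    (2 * Num.min (g x) dl + 2 / dl * `|g x * (v x - g x)|)).
  rewrite Lp_norm1E; apply: ae_le_Rintegral => //.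
    by apply: integrable_norm; exact: i3.
  apply: filterS v0 => x v0.
  rewrite -[(v - g) x]/(v x - g x) normrM (ger0_norm (g0 x)).
  have [gd|/ltW dg] := leP (g x) dl.
    have [le_vg|/ltW le_gv] := leP (v x) (g x).
      rewrite ler0_norm ?subr_le0//.
      have : 0 <= 2 / dl * (g x * - (v x - g x)).
        by rewrite mulr_ge0 ?divr_ge0 ?mulr_ge0 ?oppr_ge0 ?subr_le0// ltW.
      move: v0; lra.
    rewrite ger0_norm ?subr_ge0//.
    have : 0 <= 2 / dl * (g x * (v x - g x)).
      by rewrite mulr_ge0 ?divr_ge0 ?mulr_ge0 ?subr_ge0// ltW.
    by have := g0 x; lra.
  (* Here dl <= g, so the factor g / dl is at least 1. *)
  have dle : 2 * `|v x - g x| <= 2 / dl * (g x * `|v x - g x|).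
    rewrite mulrA ler_wpM2r// -mulrA ler_peMr// mulrC ler_pdivlMr// mul1r//.
  have : - (v x - g x) <= `|v x - g x| by rewrite -normrN ler_norm.
  lra.
have e1 : \int[mu]_x (2 * Num.min (g x) dl) = 2 * \int[mu]_x Num.min (g x) dl.
  exact: RintegralZl.
have e2 : \int[mu]_x (2 / dl * `|g x * (v x - g x)|) =
    2 / dl * \int[mu]_x `|g x * (v x - g x)| by exact: RintegralZl.
rewrite RintegralD// (RintegralD _ i1 i2)// e1 e2.
move=> h1; apply: le_trans h1 _.
have : 2 / dl * \int[mu]_x `|g x * (v x - g x)| <=
   2 / dl * (nrm2 g * nrm2 (v - g)) by rewrite ler_wpM2l// divr_ge0// ltW.
lra.
Qed.

Lemma cvg_int_min (g : T -> R) : L1 g -> (forall x, 0 <= g x) ->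
  \int[mu]_x Num.min (g x) n.+1%:R^-1 @[n --> \oo] --> (0 : R).
Proof.
move=> g1 g0.
have mg := Lp_measurable g1.
have mm n : measurable_fun setT (fun x => (Num.min (g x) n.+1%:R^-1)%:E).
  by apply/measurable_EFinP; exact: measurable_minr.
have := @dominated_convergence _ _ _ mu setT measurableT
  (fun n x => (Num.min (g x) n.+1%:R^-1)%:E) (cst 0%E) (EFin \o g) mm
  (measurable_cst _) _ ((Lp1P mu g).1 g1) _.
move=> []; [| |move=> _ _].
- apply/aeW => x _; apply: cvg_EFin; first exact: nearW.
  apply: squeeze_cvgr (cvg_cst (0 : R)) (@cvg_harmonic R).
  by apply: nearW => n /=; rewrite le_min g0/= invr_ge0 ler0n/= ge_min lexx orbT.
- apply/aeW => x n _.
  by rewrite gee0_abs lee_fin ?le_min ?g0 ?invr_ge0 ?ler0n// ge_min lexx.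
by rewrite integral_cst// mul0e => /fine_cvg.
Qed.

(** By the semigroup law [S t g - S s g] is a.e. equal to [S s (S (t - s) g - g)], so contractivity
    reduces the claim to small times, uniformly in s. There [L1_dist_le] applies, its cutoff being
    fixed before the L^2 distance is made small. *)
Lemma semigroup_L1_continuous (S : R -> (T -> R) -> T -> R) (g : T -> R) :
  contraction_semigroup mu L1 nrm1 S ->
  (forall t, 0 < t -> positivity_preserving mu L1 (S t)) ->
  (forall t, 0 < t -> L2 (S t g)) ->
  nrm2 (S t g - g) @[t --> 0^'+] --> (0 : R) ->
  L1 g -> L2 g -> (forall x, 0 <= g x) ->
  forall e : R, 0 < e -> exists2 dl : R, 0 < dl & forall s t,
     0 < s -> s <= t -> t - s <= dl -> nrm1 (S t g - S s g) <= e.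
Proof.
move=> [[opS Sadd] Sc] Spos S2 Scont g1 g2 g0 e e0.
have p1 : (1 <= 1 :> \bar R)%E by [].
have [n nP] : exists n, 2 * \int[mu]_x Num.min (g x) n.+1%:R^-1 <= e / 2.
  have /cvgrPdist_lt := cvg_int_min g1 g0.
  move=> /(_ (e / 4) ltac:(by rewrite divr_gt0)) [n _ /(_ n (leqnn n))] /=.
  rewrite sub0r normrN => h; exists n.
  by move: h => /(le_lt_trans (ler_norm _)); lra.
pose K := 2 / n.+1%:R^-1 * nrm2 g.
have K0 : 0 <= K by rewrite /K mulr_ge0 ?Lp_norm_ge0// divr_ge0// invr_ge0.
have K1 : 0 < K + 1 by lra.
have [dl /= dl0 dlP] : \forall t \near 0^'+, nrm2 (S t g - g) <= e / 2 / (K + 1).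
  have /cvgrPdist_le/(_ (e / 2 / (K + 1))) := Scont.
  move=> /(_ ltac:(by rewrite !divr_gt0)); apply: filterS => t.
  by rewrite sub0r normrN; exact: (le_trans (ler_norm _)).
have S1 t : 0 < t -> L1 (S t g) by move=> t0; exact: operator_stable (opS _ t0) _ g1.
have near0 h : 0 < h -> h <= dl / 2 -> nrm1 (S h g - g) <= e.
  move=> h0 hdl.
  have : nrm2 (S h g - g) <= e / 2 / (K + 1).
    by apply: dlP => //=; rewrite sub0r normrN gtr0_norm//; lra.
  move=> /(ler_wpM2l K0).
  have -> : K * (e / 2 / (K + 1)) = e / 2 * (K / (K + 1)) by rewrite mulrCA mulrA.
  have : e / 2 * (K / (K + 1)) <= e / 2.
    by rewrite -[leRHS]mulr1 ler_pM2l ?divr_gt0// ler_pdivrMr//; lra.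
  have := @L1_dist_le g (S h g) n.+1%:R^-1 _ g1 g2 (S1 _ h0) (S2 _ h0) g0
    (Spos _ h0 _ g1 (aeW _ g0)) (Sc _ h0 _ g1).
  rewrite invr_gt0 ltr0n => /(_ isT); rewrite mulrA -/K; lra.
(* Half of [dl], because the neighbourhood of 0 is given by a strict inequality. *)
exists (dl / 2); first by rewrite divr_gt0.
move=> s t s0; rewrite le_eqVlt => /predU1P[->|st] ts.
  rewrite subrr Lp_norm1E; under eq_Rintegral do rewrite normr0.
  by rewrite Rintegral_cst// mul0r ltW.
have h0 : 0 < t - s by rewrite subr_gt0.
have t0 : 0 < t by exact: lt_trans st.
have B1 : L1 (S (t - s) g - g) by apply: LpB => //; exact: S1.
apply: le_trans (near0 _ h0 ts); apply: le_trans (Sc _ s0 _ B1).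
rewrite le_eqVlt; apply/orP; left; apply/eqP; apply: Lp_norm1_ae.
- by apply: LpB => //; exact: S1.
- exact: operator_stable (opS _ s0) _ B1.
have := Sadd _ _ _ s0 h0 g1; rewrite (addrC s) subrK.
have := operator_linear (opS _ s0) (-1) g1 (S1 _ h0).
rewrite scaleN1r addrC.
apply: filterS2 => x /(_ I) lin /(_ I) add _.
rewrite -[LHS]/(S t g x - S s g x) add lin.
by rewrite -[RHS]/(-1 * S s g x + S s (S (t - s) g) x) mulN1r addrC.
Qed.

End L1_continuity.

(* Positive rationals are written k.+1 / n.+1, so that countably many almost
   sure inequalities can be merged by ae_foralln. *)
Lemma quadratic_le_of_rational (R : realType) (p q u : R) : 0 <= u ->
  (forall k n : nat, let c := k.+1%:R / n.+1%:R in
     (1 + c) ^+ 2 * q <= c ^+ 2 + p) ->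
  (1 + u) ^+ 2 * q <= u ^+ 2 + p.
Proof.
move=> u0 H.
(* The successor makes [c n] positive even for u = 0 and puts it above u by at most 1 / (n + 1). *)
pose c n : R := (Num.truncn (u * n.+1%:R)).+1%:R / n.+1%:R.
have cu : c @ \oo --> u.
  have hu : (fun n : nat => u + n.+1%:R^-1) @ \oo --> u.
    by rewrite -[X in _ --> X]addr0; apply: cvgD; [exact: cvg_cst|exact: cvg_harmonic].
  apply: squeeze_cvgr (cvg_cst u) hu; apply: nearW => n.
  have n0 : 0 < n.+1%:R :> R by rewrite ltr0n.
  have un0 : 0 <= u * n.+1%:R by rewrite mulr_ge0// ltW.
  have /andP[h1 h2] := truncn_itv un0.
  rewrite /c ler_pdivlMr// ltW//= ler_pdivrMr// mulrDl mulVf ?gt_eqF//.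
  by rewrite -natr1 lerD2r.
have c1 : (1 + c n) ^+ 2 * q - (c n) ^+ 2 @[n --> \oo] --> (1 + u) ^+ 2 * q - u ^+ 2.
  have d1 : (1 + c n) @[n --> \oo] --> 1 + u by apply: cvgD => //; exact: cvg_cst.
  apply: cvgB; last by rewrite expr2; under eq_fun do rewrite expr2; exact: cvgM.
  by apply: cvgMl; rewrite expr2; under eq_fun do rewrite expr2; exact: cvgM.
rewrite [leRHS]addrC -lerBlDr; apply: (cvgr_to_le c1).
by apply: nearW => n; rewrite lerBlDr [leRHS]addrC; exact: H.
Qed.

(** * Sub-Markovian resolvents *)

Section resolvent.
Context d (T : measurableType d) (R : realType).
Variable mu : {measure set T -> \bar R}.
Local Notation L2 := (Lp mu 2%:E).
Local Notation nrm2 := (Lp_norm mu 2%:E).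
Variable G : R -> (T -> R) -> T -> R.
Hypothesis resolventG : C0_contraction_resolvent mu L2 nrm2 G.
Hypothesis markovG : forall a, 0 < a -> sub_markovian mu (fun f => a *: G a f).
Implicit Types (f g h : T -> R) (a : R).

Let p2 : (1 <= 2%:E :> \bar R)%E. Proof. exact: lee1n. Qed.

Let opG a : 0 < a -> operator_on mu L2 (G a).
Proof. by case: resolventG => + _ _ _; apply. Qed.

Lemma resolvent_L2 a f : 0 < a -> L2 f -> L2 (G a f).
Proof. by move=> a0; exact: (operator_stable (opG a0)). Qed.

Lemma resolventZD a c f g : 0 < a -> L2 f -> L2 g ->
  \forall x \ae mu, G a (c *: f + g) x = c * G a f x + G a g x.
Proof.
move=> a0 f2 g2; have := operator_linear (opG a0) c f2 g2.
by apply: filterS => x /(_ I).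
Qed.

Lemma resolventB a f g : 0 < a -> L2 f -> L2 g ->
  \forall x \ae mu, G a (f - g) x = G a f x - G a g x.
Proof.
move=> a0 f2 g2; rewrite addrC -scaleN1r.
by apply: filterS (resolventZD (-1) a0 g2 f2) => x ->; rewrite mulN1r addrC.
Qed.

Lemma resolventZ a c f : 0 < a -> L2 f ->
  \forall x \ae mu, G a (c *: f) x = c * G a f x.
Proof.
move=> a0 f2; have z2 : L2 0 by exact: Lp_cst0.
have := resolventZD (-1) a0 z2 z2; rewrite scaler0 addr0.
rewrite -[c *: f]addr0; apply: filterS2 (resolventZD c a0 f2 z2) => x -> ->.
by rewrite mulN1r addNr addr0.
Qed.

Lemma resolvent_eq a f g : 0 < a -> L2 f -> L2 g ->
  (\forall x \ae mu, f x = g x) -> \forall x \ae mu, G a f x = G a g x.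
Proof.
move=> a0 f2 g2 fg; have : f = g %[ae mu] by apply: filterS fg => x ? _.
by move=> /(operator_ae (opG a0) f2 g2); apply: filterS => x /(_ I).
Qed.

Lemma resolvent_identity a b f : 0 < a -> 0 < b -> L2 f ->
  \forall x \ae mu, G a f x - G b f x = (b - a) * G a (G b f) x.
Proof.
move=> a0 b0 f2; case: resolventG => _ _ /(_ _ _ _ a0 b0 f2) + _.
by apply: filterS => x /(_ I).
Qed.

Lemma resolvent_contraction a f : 0 < a -> L2 f -> a * nrm2 (G a f) <= nrm2 f.
Proof.
move=> a0 f2; case: resolventG => _ + _ _ => /(_ _ a0 _ f2).
by rewrite Lp_normZ ?gtr0_norm//; exact: resolvent_L2.
Qed.

Lemma resolvent_bounds a f (M : R) : 0 < a -> 0 < M -> L2 f ->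
  (\forall x \ae mu, 0 <= f x <= M) ->
  \forall x \ae mu, 0 <= a * G a f x <= M.
Proof.
move=> a0 M0 f2 fM.
have : \forall x \ae mu, 0 <= (M^-1 *: f) x <= 1.
  apply: filterS fM => x /andP[f0 fM].
  have MV0 : 0 <= M^-1 by rewrite invr_ge0 ltW.
  by rewrite -[(_ *: _) x]/(M^-1 * f x) mulr_ge0//= ler_pdivrMl// mulr1.
move=> /(markovG a0 (LpZ M^-1 p2 f2)).
apply: filterS2 (resolventZ M^-1 a0 f2) => x e.
rewrite -[(_ *: _) x]/(a * G a (M^-1 *: f) x) e.
rewrite mulrCA => /andP[h1 h2]; apply/andP; split.
  by move: h1; rewrite pmulr_rge0// invr_gt0.
by move: h2; rewrite ler_pdivrMl// mulr1.
Qed.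

(** Sub-Markovianity speaks of bounded functions, so positivity of [G a] is applied to a bounded
    difference g - f; hence the bound [M]. *)
Lemma resolvent_mono a f g (M : R) : 0 < a -> L2 f -> L2 g ->
  (\forall x \ae mu, f x <= g x) -> (\forall x \ae mu, g x - f x <= M) ->
  \forall x \ae mu, G a f x <= G a g x.
Proof.
move=> a0 f2 g2 fg gM; have M0 : 0 < `|M| + 1 by rewrite ltr_wpDl.
have gf2 : L2 (g - f) by exact: LpB.
have : \forall x \ae mu, 0 <= (g - f) x <= `|M| + 1.
  apply: filterS2 fg gM => x fg gM.
  rewrite -[(g - f) x]/(g x - f x) subr_ge0 fg/= (le_trans gM)//.
  by rewrite (le_trans (ler_norm M))// lerDl.
move=> /(resolvent_bounds a0 M0 gf2).
apply: filterS2 (resolventB a0 g2 f2) => x -> /andP[+ _].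
by rewrite pmulr_rge0// subr_ge0.
Qed.

(** For h' <= 1 the excess (h - 1)^+ is at most |h' - h|, so its L^2 norm is at most every e > 0. *)
Lemma L2_limit_le1 h : L2 h ->
  (forall e : R, 0 < e -> exists h', [/\ L2 h', \forall x \ae mu, h' x <= 1 &
     nrm2 (h' - h) <= e]) ->
  \forall x \ae mu, h x <= 1.
Proof.
move=> h2 H; pose k x := Num.max (h x - 1) 0.
have mk : measurable_fun setT k.
  apply: measurable_maxr => //; apply: measurable_funB => //.
  exact: Lp_measurable h2.
have k2 : L2 k.
  apply: Lp2_le h2 => // x; rewrite /k.
  have [_|h1] := leP (h x - 1) 0; first by rewrite normr0.
  by rewrite !ger0_norm; lra.
have : nrm2 k = 0.
  apply/eqP; rewrite eq_le Lp_norm_ge0 andbT.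
  apply/ler_addgt0Pr => e /H[h' [h'2 h'1 le]].
  rewrite add0r; apply: le_trans le; apply: Lp_norm2_le => //; first exact: LpB.
  apply: filterS h'1 => x h'1; rewrite -[(h' - h) x]/(h' x - h x) /k distrC.
  have [_|h1] := leP (h x - 1) 0; first by rewrite normr0.
  by rewrite !ger0_norm; lra.
move=> /(Lp_norm2_eq0 k2); apply: filterS => x; rewrite /k.
by have [|] := leP (h x - 1) 0; lra.
Qed.

(** * The estimate for the weighted function at a fixed resolvent parameter *)

Section bound.
Variables (a : R) (f : T -> R).
Hypothesis a0 : 0 < a.
Hypothesis f2 : L2 f.
Hypothesis f01 : forall x, 0 <= f x <= 1.

(** [u] is a version of G_a f that is nonnegative everywhere. With phi(s) = s / (1 + s), [q] is
    phi(u) and [m] is phi'(u). *)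
Let u x := Num.max (G a f x) 0.
Let q x := u x / (1 + u x).
Let m x := (1 + u x) ^- 2.

Let u0 x : 0 <= u x. Proof. by rewrite /u le_max lexx orbT. Qed.

Let u1 x : 0 < 1 + u x. Proof. by rewrite ltr_pwDl. Qed.

Let u_meas : measurable_fun setT u.
Proof.
by apply: measurable_maxr => //; apply: Lp_measurable (resolvent_L2 a0 f2).
Qed.

Let Vu1_meas : measurable_fun setT (fun x => (1 + u x)^-1).
Proof.
rewrite (_ : (fun _ => _) = @powR R ^~ (-1) \o (fun x => 1 + u x)).
  by apply: measurableT_comp => //; exact: measurable_funD.
by apply/funext => x /=; rewrite powR_inv1// ltW.
Qed.

Let u2 : L2 u.
Proof.
apply: Lp2_le (resolvent_L2 a0 f2) => // x; rewrite ger0_norm// /u.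
by rewrite ge_max ler_norm normr_ge0.
Qed.

Let q2 : L2 q.
Proof.
apply: Lp2_le u2; first exact: measurable_funM.
have q0 x : 0 <= q x by rewrite /q divr_ge0// ltW.
move=> x; rewrite (ger0_norm (q0 x)) ger0_norm// /q.
by rewrite ler_pdivrMr// ler_peMr// lerDl.
Qed.

Let q1 x : 0 <= q x <= 1.
Proof.
apply/andP; split; first by rewrite /q divr_ge0// ltW.
by rewrite /q ler_pdivrMr// mul1r lerDr.
Qed.

Let m01 x : 0 < m x <= 1.
Proof.
by rewrite /m invr_gt0 exprn_gt0//= invf_le1 ?exprn_gt0// exprn_ege1// lerDl.
Qed.

Let m_meas : measurable_fun setT m.
Proof.
rewrite (_ : m = fun x => (1 + u x)^-1 ^+ 2); first exact: measurable_funX.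
by apply/funext => x; rewrite /m exprVn.
Qed.

Let m2 g : L2 g -> L2 (fun x => m x * g x).
Proof.
move=> g2; apply: (Lp2_le _ _ g2).
  by apply: measurable_funM => //; exact: Lp_measurable g2.
move=> x; have /andP[h1 h2] := m01 x.
by rewrite normrM gtr0_norm// ler_piMl.
Qed.

Let uG : \forall x \ae mu, u x = G a f x.
Proof.
have := resolvent_bounds a0 ltr01 f2 (aeW _ f01).
by apply: filterS => x /andP[+ _]; rewrite pmulr_rge0// /u => ?; rewrite max_l.
Qed.

Let ub : \forall x \ae mu, u x <= a^-1.
Proof.
apply: filterS2 uG (resolvent_bounds a0 ltr01 f2 (aeW _ f01)) => x -> /andP[_].
by rewrite mulrC -ler_pdivlMr// mul1r.
Qed.

Section gamma.
Variable c : R.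
Hypothesis ac : a < c.
Let b := c - a.
Let b0 : 0 < b. Proof. by rewrite subr_gt0. Qed.
Let c0 : 0 < c. Proof. exact: lt_trans ac. Qed.
Let bc : b <= c. Proof. by rewrite /b gerBl ltW. Qed.

Let u_sub : \forall x \ae mu, b * G c u x = u x - G c f x.
Proof.
have Ga2 := resolvent_L2 a0 f2.
have /= := resolvent_identity c0 a0 f2.
apply: filterS3 uG (resolvent_eq c0 u2 Ga2 uG) => x -> -> e.
by rewrite /b -opprB mulNr -e; ring.
Qed.

(* Jensen's inequality for the concave function s / (1 + s), through its
   tangent at r. *)
Let tangent (r : R) : 0 < r ->
  \forall x \ae mu, (1 + r) ^+ 2 * (b * G c q x) <= r ^+ 2 + (u x - G c f x).
Proof.
(* [D] is the slope of s / (1 + s) at r, and [C] is the value at 0 of the tangent there: r / (1 + r)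
   - r D = r^2 D. *)
move=> r0; pose D := (1 + r) ^- 2; pose C := r ^+ 2 * D.
have r1 : 0 < (1 + r) ^+ 2 by rewrite exprn_gt0// ltr_pwDl// ltW.
have D0 : 0 < D by rewrite invr_gt0.
have C0 : 0 < C by rewrite mulr_gt0// exprn_gt0.
have qC x : q x - D * u x <= C.
  have -> : C = r ^+ 2 * D by [].
  rewrite lerBlDr /q ler_pdivrMr// (_ : _ * (1 + u x) = (r ^+ 2 + u x) * (1 + u x) / (1 + r) ^+ 2).
    rewrite ler_pdivlMr//.
    by have := u0 x; have := sqr_ge0 (r - u x); nra.
  by rewrite -/D; ring.
pose k := (- D) *: u + q.
have k2 : L2 k by apply: Lp_lin.
have kE x : k x = q x - D * u x.
  by rewrite /k -[LHS]/((- D) * u x + q x) mulNr addrC.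
(* [k] may be negative, while the sub-Markov bound concerns functions between 0 and [C]. An upper
   bound for G_c k is wanted, so its positive part can replace it. *)
pose w x := Num.max (k x) 0.
have w2 : L2 w.
  apply: (Lp2_le _ _ k2); first by apply: measurable_maxr => //; exact: Lp_measurable k2.
  by move=> x; rewrite ger0_norm /w ?le_max ?lexx ?orbT// ge_max ler_norm normr_ge0.
have w01 x : 0 <= w x <= C.
  by rewrite /w le_max lexx orbT/= ge_max kE qC ltW.
have kw : \forall x \ae mu, G c k x <= G c w x.
  (* w - k is at most C + D / a because w <= C, q >= 0 and u <= 1 / a. *)
  apply: (@resolvent_mono _ _ _ (C + D * a^-1)) => //.
    by apply: aeW => x; rewrite /w le_max lexx.
  apply: filterS ub => x ubx.
  have /andP[_ wC] := w01 x; have /andP[q0 _] := q1 x.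
  have : D * u x <= D * a^-1 by rewrite ler_pM2l.
  by rewrite kE; lra.
have kq := resolventZD (- D) c0 u2 q2.
have wb := resolvent_bounds c0 C0 w2 (aeW _ w01).
apply: filterS3 u_sub (filterI kw kq) wb => x us [kw' kq'] /andP[w0' wC'].
have Gw0 : 0 <= G c w x by move: w0'; rewrite pmulr_rge0.
have h : b * (- D * G c u x + G c q x) <= C.
  rewrite -kq' (le_trans _ wC')// (@le_trans _ _ (b * G c w x))//.
    by rewrite ler_pM2l.
  by rewrite ler_wpM2r.
have : (1 + r) ^+ 2 * (b * (- D * G c u x + G c q x)) <= (1 + r) ^+ 2 * C.
  by rewrite ler_pM2l.
have -> : (1 + r) ^+ 2 * C = r ^+ 2 by rewrite /C /D mulrCA divff ?mulr1// gt_eqF.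
rewrite mulrDr mulrDr.
have -> : (1 + r) ^+ 2 * (b * (- D * G c u x)) = - (b * G c u x).
  by rewrite mulrCA mulNr mulrN mulrA /D divff ?gt_eqF// mul1r mulrN.
rewrite us; lra.
Qed.

(** The best tangent at x is the one at r = u x. Since r then varies with x, the a.e. inequalities
    for countably many r are merged beforehand; the identity u^2 + u = (1 + u)^2 q concludes. *)
Let jensen : \forall x \ae mu, m x * G c f x <= q x - b * G c q x.
Proof.
have H : \forall x \ae mu, forall k n : nat, let r := k.+1%:R / n.+1%:R in
    (1 + r) ^+ 2 * (b * G c q x) <= r ^+ 2 + (u x - G c f x).
  apply: ae_foralln => k; apply: ae_foralln => n; apply: tangent.
  by rewrite divr_gt0// ltr0n.
apply: filterS H => x /(quadratic_le_of_rational (u0 x)) h.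
have p0 : 0 < (1 + u x) ^+ 2 by rewrite exprn_gt0.
rewrite -(ler_pM2l p0) /m mulrA divff ?gt_eqF// mul1r mulrBr.
have -> : (1 + u x) ^+ 2 * q x = (1 + u x) * u x.
  by rewrite /q; field; rewrite gt_eqF.
lra.
Qed.

(** Apply G_a to [jensen]: by the resolvent identity with b = c - a, G_a (q - b G_c q) = G_c q, and
    b G_c q <= c G_c q <= 1. *)
Lemma resolvent_bound_gamma :
  \forall x \ae mu, b * G a (fun x => m x * G c f x) x <= 1.
Proof.
have Gf2 := resolvent_L2 c0 f2; have Gq2 := resolvent_L2 c0 q2.
have kq2 : L2 ((- b) *: G c q + q) by apply: Lp_lin.
have h1 : \forall x \ae mu, m x * G c f x <= ((- b) *: G c q + q) x.
  apply: filterS jensen => x; rewrite -[X in _ -> _ <= X]/((- b) * G c q x + q x).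
  by rewrite mulNr addrC.
have Gfb := resolvent_bounds c0 ltr01 f2 (aeW _ f01).
have Gqb := resolvent_bounds c0 ltr01 q2 (aeW _ q1).
have h2 : \forall x \ae mu, ((- b) *: G c q + q) x - m x * G c f x <= 1.
  apply: filterS2 Gfb Gqb => x /andP[f0 _] /andP[q0 _].
  rewrite -[X in X - _]/((- b) * G c q x + q x).
  have : 0 <= b * G c q x by rewrite mulr_ge0 ?(ltW b0)//; move: q0; rewrite pmulr_rge0.
  have : 0 <= m x * G c f x.
    rewrite mulr_ge0//; last by move: f0; rewrite pmulr_rge0.
    by have /andP[/ltW] := m01 x.
  by have /andP[_] := q1 x; lra.
have := resolvent_mono a0 (m2 Gf2) kq2 h1 h2.
apply: filterS3 (resolventZD (- b) a0 Gq2 q2)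
  (filterI (resolvent_identity a0 c0 q2) Gqb) => x e [id /andP[q0 q1']] le.
have Gq0 : 0 <= G c q x by move: q0; rewrite pmulr_rge0.
have : b * G a (fun x => m x * G c f x) x <= b * G c q x.
  by rewrite ler_pM2l// (le_trans le)// e; move: id; rewrite -/b; lra.
move=> /le_trans; apply; apply: le_trans q1'.
by rewrite ler_wpM2r.
Qed.

End gamma.

(** Let c tend to infinity. As G_a has norm at most 1 / a and 0 < m <= 1, the L^2 distance from b
    G_a (m G_c f) to G_a (m f) is at most 1 / a times that from b G_c f to f. The latter is at most
    the norm of c G_c f - f plus a / c times the norm of f. *)
Let resolvent_bound_m : \forall x \ae mu, G a (fun x => m x * f x) x <= 1.
Proof.
have mf2 := m2 f2; have Gmf2 := resolvent_L2 a0 mf2.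
apply: L2_limit_le1 => // e e0.
have ae0 : 0 < a * e / 2 by rewrite !mulr_gt0.
have [c [ac cf ce]] : exists c, [/\ a < c, nrm2 (c *: G c f - f) <= a * e / 2 &
    nrm2 f / c <= e / 2].
  case: resolventG => _ _ _ /(_ _ f2)/cvgrPdist_le/(_ _ ae0) H.
  near (pinfty_nbhs R) => c.
  have cf : nrm2 f / (e / 2) < c by near: c; apply: nbhs_pinfty_gt; exact: num_real.
  have ac : a < c by near: c; apply: nbhs_pinfty_gt; exact: num_real.
  exists c; split => //.
  - have : `|0 - nrm2 (c *: G c f - f)| <= a * e / 2 by near: c; exact: H.
    by rewrite sub0r normrN => /(le_trans (ler_norm _)).
  - have c0 : 0 < c by exact: lt_trans ac.
    by rewrite ler_pdivrMr// mulrC -ler_pdivrMr ?divr_gt0// ltW.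
have c0 : 0 < c by exact: lt_trans ac.
have v2 := resolvent_L2 c0 f2; have mv2 := m2 v2.
have Gmv2 := resolvent_L2 a0 mv2.
pose b := c - a.
exists (b *: G a (fun x => m x * G c f x)); split; first exact: LpZ.
  by apply: filterS (resolvent_bound_gamma ac).
have bmv2 : L2 (b *: (fun x => m x * G c f x)) by exact: LpZ.
pose k := b *: (fun x => m x * G c f x) - (fun x => m x * f x).
have k2 : L2 k by exact: LpB.
have bv2 : L2 (b *: G c f - f) by apply: LpB => //; exact: LpZ.
have le1 : nrm2 (b *: G a (fun x => m x * G c f x) - G a (fun x => m x * f x)) <=
    nrm2 (G a k).
  apply: Lp_norm2_le; [by apply: LpB => //; exact: LpZ|exact: resolvent_L2|].
  apply: filterS2 (resolventB a0 bmv2 mf2) (resolventZ b a0 mv2) => x -> ->.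
  exact: lexx.
have le2 : nrm2 k <= nrm2 (b *: G c f - f).
  apply: Lp_norm2_le => //; apply: aeW => x.
  have -> : k x = m x * (b *: G c f - f) x.
    rewrite -[LHS]/(b * (m x * G c f x) - m x * f x).
    by rewrite -[(b *: G c f - f) x]/(b * G c f x - f x); ring.
  have /andP[h1 h2] := m01 x.
  by rewrite normrM gtr0_norm// ler_piMl.
have le3 : nrm2 (b *: G c f - f) <= a * e / 2 + a * (e / 2).
  have -> : b *: G c f - f = (c *: G c f - f) + (- a) *: G c f.
    by rewrite /b scalerDl addrAC.
  apply: le_trans (ler_Lp_normD p2 _ _) _.
  - by apply: LpB => //; exact: LpZ.
  - exact: LpZ.
  apply: lerD => //; rewrite Lp_normZ// normrN gtr0_norm// ler_pM2l//.
  apply: le_trans ce; rewrite ler_pdivlMr// mulrC.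
  exact: resolvent_contraction.
have := resolvent_contraction a0 k2 => le4.
apply: le_trans le1 _; rewrite -(ler_pM2l a0).
apply: le_trans le4 _; apply: le_trans le2 _; apply: le_trans le3 _.
by rewrite -mulrA -mulrDr -splitr.
Unshelve. all: by end_near. Qed.

(** A larger [w] makes the weight smaller, and G_a is monotone. The gain is that [w] may be chosen
    independent of a. *)
Lemma resolvent_bound (w : T -> R) : measurable_fun setT w ->
  (forall x, 0 <= w x) -> (\forall x \ae mu, G a f x <= w x) ->
  L2 (fun x => (1 + w x) ^- 2 * f x) /\
  \forall x \ae mu, G a (fun x => (1 + w x) ^- 2 * f x) x <= 1.
Proof.
move=> mw w0 Gw.
have w1 x : 0 < 1 + w x by rewrite ltr_pwDl.
have wm01 x : 0 < (1 + w x) ^- 2 <= 1.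
  by rewrite invr_gt0 exprn_gt0//= invf_le1 ?exprn_gt0// exprn_ege1// lerDl.
have wf2 : L2 (fun x => (1 + w x) ^- 2 * f x).
  apply: (Lp2_le _ _ f2) => [|x]; last first.
    by have /andP[h1 h2] := wm01 x; rewrite normrM gtr0_norm// ler_piMl.
  apply: measurable_funM; last exact: Lp_measurable f2.
  rewrite (_ : (fun _ => _) = fun x => ((1 + w x) `^ (-1)) ^+ 2).
    apply: measurable_funX; apply: (@measurableT_comp _ _ _ _ _ _ (@powR R ^~ (-1))) => //.
    exact: measurable_funD.
  by apply/funext => x; rewrite powR_inv1 ?exprVn// ltW.
split => //.
have le : \forall x \ae mu, (1 + w x) ^- 2 * f x <= m x * f x.
  apply: filterS2 uG Gw => x ux Gx; have /andP[f0 _] := f01 x.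
  rewrite ler_wpM2r// /m lef_pV2 ?posrE ?exprn_gt0//.
  by rewrite lerXn2r ?nnegrE ?(ltW (u1 x)) ?(ltW (w1 x))// lerD2l ux.
have d1 : \forall x \ae mu, m x * f x - (1 + w x) ^- 2 * f x <= 1.
  apply: aeW => x; have /andP[f0 f1] := f01 x.
  have /andP[/ltW m0 m1] := m01 x; have /andP[/ltW wm0 wm1] := wm01 x.
  have : m x * f x <= 1 by rewrite mulr_ile1.
  have : 0 <= (1 + w x) ^- 2 * f x by rewrite mulr_ge0.
  lra.
apply: filterS2 resolvent_bound_m (resolvent_mono a0 wf2 (m2 f2) le d1) => x.
by move=> /[swap]; exact: le_trans.
Qed.

End bound.
End resolvent.

(** * Potentials *)

Section weak_comparison.
Context d (T : measurableType d) (R : realType).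
Variable mu : {measure set T -> \bar R}.
Variable f : T -> R.
Hypothesis mf : measurable_fun setT f.
Hypothesis f0 : forall x, 0 <= f x.

(** A single error [e] serves all test functions, so that the test function may be chosen depending
    on h and k. *)
Definition weak_le (h k : T -> R) (e : R) : Prop :=
  forall w : T -> R, measurable_fun setT w -> (forall x, 0 <= w x <= f x) ->
    ip mu h w <= ip mu k w + e.

Variables h k : T -> R.
Hypotheses (mh : measurable_fun setT h) (mk : measurable_fun setT k).
Hypotheses (ih : mu.-integrable setT (EFin \o (h \* f)))
  (ik : mu.-integrable setT (EFin \o (k \* f))).

(** The extremal test function is f on the set where k < h and 0 elsewhere. *)
Lemma weak_le_excess e : weak_le h k e ->
  mu.-integrable setT (EFin \o (fun x => f x * Num.max (h x - k x) 0)) /\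
  \int[mu]_x (f x * Num.max (h x - k x) 0) <= e.
Proof.
move=> hk; pose w x := if k x < h x then f x else 0.
have mw : measurable_fun setT w.
  by apply: measurable_fun_ifT => //; exact: measurable_fun_ltr.
have w0 x : 0 <= w x <= f x by rewrite /w; case: ifPn => _; rewrite ?f0 ?lexx.
have wi (g : T -> R) : measurable_fun setT g -> mu.-integrable setT (EFin \o (g \* f)) ->
    mu.-integrable setT (EFin \o (fun x => g x * w x)).
  move=> mg; apply: le_integrable => //.
    by apply/measurable_EFinP; exact: measurable_funM.
  move=> x _; rewrite lee_fin /= !normrM ler_wpM2l//.
  by have /andP[h1 h2] := w0 x; rewrite !ger0_norm.
have iB := integrableB measurableT (wi _ mh ih) (wi _ mk ik).
have E x : f x * Num.max (h x - k x) 0 = h x * w x - k x * w x.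
  rewrite -mulrBl mulrC /w; case: (ltP (k x) (h x)) => [kh|hk'].
    by rewrite max_l// subr_ge0 ltW.
  by rewrite max_r ?subr_le0// mul0r mulr0.
split; first by apply: eq_integrable iB => // x _ /=; rewrite E.
under eq_Rintegral do rewrite E.
rewrite RintegralB//; [|exact: wi..].
by rewrite lerBlDl; exact: hk.
Qed.

Hypothesis fpos : \forall x \ae mu, 0 < f x.

Lemma weak_le_ae : weak_le h k 0 -> \forall x \ae mu, h x <= k x.
Proof.
move=> /weak_le_excess[iE E0].
have : ae_eq mu setT (EFin \o (fun x => f x * Num.max (h x - k x) 0)) (cst 0%E).
  apply/(ae_eq_integral_abs mu measurableT (measurable_int mu iE)).
  apply/eqP; rewrite eq_le integral_ge0// andbT.
  under eq_integral do rewrite /= ger0_norm ?mulr_ge0 ?le_max ?lexx ?orbT//.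
  by rewrite -lee_fin fineK ?integrable_fin_num in E0.
apply: filterS2 fpos => x f_gt0 /(_ I) [] /eqP.
rewrite mulf_eq0 gt_eqF//= => /eqP.
by have [|] := leP (h x - k x) 0; lra.
Qed.

End weak_comparison.

Section fine_limn_esup.
Context (R : realType).

Lemma fine_limn_esupE (u : nat -> R) l : u @ \oo --> l ->
  fine (limn_esup (fun n => (u n)%:E)) = l.
Proof.
move=> ul; have ulE : (u n)%:E @[n --> \oo] --> l%:E.
  by apply: cvg_EFin => //; exact: nearW.
by rewrite (cvg_limn_einf_sup ulE).2.
Qed.

Lemma measurable_fine_limn_esup d (T : measurableType d) (u : nat -> T -> R) :
  (forall n, measurable_fun setT (u n)) ->
  measurable_fun setT (fun x => fine (limn_esup (fun n => (u n x)%:E))).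
Proof.
move=> mu; apply: measurableT_comp => //; apply: measurable_fun_limn_esup => n.
exact/measurable_EFinP.
Qed.

End fine_limn_esup.

Section potential.
Context d (T : measurableType d) (R : realType).
Variable mu : {measure set T -> \bar R}.
Local Notation L1 := (Lp mu 1).
Local Notation L2 := (Lp mu 2%:E).
Local Notation nrm1 := (Lp_norm mu 1).
Local Notation nrm2 := (Lp_norm mu 2%:E).
Variables S G : R -> (T -> R) -> T -> R.
Hypothesis resolventG : C0_contraction_resolvent mu L2 nrm2 G.
Hypothesis markovG : forall a, 0 < a -> sub_markovian mu (fun f => a *: G a f).
Hypothesis semigroupS : C0_contraction_semigroup mu L2 nrm2 S.
Hypothesis resolventS : resolvent_of_semigroup L2 nrm2 S G.
Hypothesis semigroupS1 : contraction_semigroup mu L1 nrm1 S.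
Hypothesis positiveS1 : forall t, 0 < t -> positivity_preserving mu L1 (S t).

Let p1 : (1 <= 1 :> \bar R)%E. Proof. by []. Qed.
Let p2 : (1 <= 2%:E :> \bar R)%E. Proof. exact: lee1n. Qed.

Let S_L1 t g : 0 < t -> L1 g -> L1 (S t g).
Proof. by move=> t0; case: semigroupS1 => -[op _] _; exact: (operator_stable (op _ t0)). Qed.

Let S_L2 t g : 0 < t -> L2 g -> L2 (S t g).
Proof.
by move=> t0; case: semigroupS => -[[op _] _ _] _; exact: (operator_stable (op _ t0)).
Qed.

Let S_mono t g h : 0 < t -> L1 g -> L1 h -> (\forall x \ae mu, g x <= h x) ->
  \forall x \ae mu, S t g x <= S t h x.
Proof.
move=> t0 g1 h1 gh; have hg1 : L1 (h - g) by exact: LpB.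
have : \forall x \ae mu, 0 <= (h - g) x.
  by apply: filterS gh => x ?; rewrite -[(h - g) x]/(h x - g x) subr_ge0.
move=> /(positiveS1 t0 hg1).
case: semigroupS1 => -[op _] _.
have := operator_linear (op _ t0) (-1) g1 h1; rewrite scaleN1r addrC.
apply: filterS2 => x /(_ I) ->.
by rewrite -[X in 0 <= X]/(-1 * S t g x + S t h x) mulN1r addrC subr_ge0.
Qed.

Let ip_mono (g h w : T -> R) : L1 g -> L1 h -> measurable_fun setT w ->
  (forall x, 0 <= w x <= 1) -> (\forall x \ae mu, g x <= h x) ->
  ip mu g w <= ip mu h w.
Proof.
move=> g1 h1 mw w01 gh.
have wn x : `|w x| <= 1 by have /andP[? ?] := w01 x; rewrite ger0_norm.
apply: ae_le_Rintegral; [exact: ip1_integrable|exact: ip1_integrable|].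
by apply: filterS gh => x gh; rewrite ler_wpM2r//; have /andP[] := w01 x.
Qed.


Section approx.
Variables (w : T -> R).
Hypothesis mw : measurable_fun setT w.
Hypothesis w01 : forall x, 0 <= w x <= 1.

Let wn x : `|w x| <= 1.
Proof. by have /andP[? ?] := w01 x; rewrite ger0_norm. Qed.

Lemma ip_semigroup_ge0 t g : 0 < t -> L1 g -> (\forall x \ae mu, 0 <= g x) ->
  0 <= ip mu (S t g) w.
Proof.
move=> t0 g1 g0; rewrite -[leLHS](_ : ip mu (cst 0) w = 0).
  apply: ip_mono => //; [exact: Lp_cst0|exact: S_L1|exact: positiveS1].
by rewrite /ip; under eq_Rintegral do rewrite mul0r; rewrite Rintegral_cst// mul0r.
Qed.

Lemma ip_semigroup_le t g : 0 < t -> L1 g -> ip mu (S t g) w <= nrm1 g.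
Proof.
move=> t0 g1; apply: le_trans (ler_norm _) _.
apply: le_trans (ip_le1 mw wn (S_L1 t0 g1)) _.
by case: semigroupS1 => _ /(_ _ t0 _ g1).
Qed.

(** The L^1-valued integral here and the L^2-valued Laplace transform in [approx_L2] are both
    reduced to the scalar function [t |-> ip mu (S t g) w], so their integrands can be compared
    pointwise in t. *)
Lemma approx_L1 g N J : L1 g ->
  is_bochner_integral L1 nrm1 `]0, N%:R[ (fun t => S t g) J ->
  integral_approx ((fun t => ip mu (S t g) w) \_ (`]0, N%:R[%classic : set R))
    (ip mu J w).
Proof.
move=> g1 gJ; apply: (bochner_integral_approx _ _ _ _ (ip_functional1 mu mw wn) _ gJ).
- exact: Lp_cst0.
- by move=> *; exact: Lp_lin.
- exact: Lp_norm_ge0.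
- exact: measurable_itv.
- by move=> t /=; rewrite in_itv/= => /andP[t0 _]; exact: S_L1.
Qed.

Hypothesis w2 : L2 w.

Lemma approx_L2 g a : 0 < a -> L2 g ->
  integral_approx
    ((fun t => expR (- (a * t)) * ip mu (S t g) w) \_ (`]0, +oo[%classic : set R))
    (ip mu (G a g) w).
Proof.
move=> a0 g2.
have lw := ip_functional2 w2.
have H : integral_approx
    (((ip mu ^~ w) \o (fun t => expR (- (a * t)) *: S t g)) \_ (`]0, +oo[%classic : set R))
    (ip mu (G a g) w).
  apply: (bochner_integral_approx _ _ _ _ lw _ (resolventS a0 g2)).
  - exact: Lp_cst0.
  - by move=> *; exact: Lp_lin.
  - exact: Lp_norm_ge0.
  - exact: measurable_itv.
  - by move=> t /=; rewrite in_itv/= andbT => t0; apply: LpZ => //; exact: S_L2.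
congr (integral_approx _ _): H; apply/funext => t; rewrite !patchE.
case: ifPn => // /set_mem/=; rewrite in_itv/= andbT => t0.
rewrite /ip -RintegralZl//; last exact: (ipE_integrable (S_L2 t0 g2) w2).
by apply: eq_Rintegral => x _; rewrite mulrA.
Qed.

End approx.

(** * Comparison of the resolvent with the potential *)

Section transient.
Variables (f0 : T -> R) (Gf0 : T -> \bar R) (J0 : nat -> T -> R).
Hypothesis f0_L1 : L1 f0.
Hypothesis f0_gt0 : \forall x \ae mu, 0 < f0 x.
Hypothesis J0P : forall N, is_bochner_integral L1 nrm1 `]0, N%:R[
  (fun t => S t f0) (J0 N).
Hypothesis J0_cvg : \forall x \ae mu, (J0 N x)%:E @[N --> \oo] --> Gf0 x.
Hypothesis Gf0_lty : \forall x \ae mu, (Gf0 x < +oo)%E.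

(** Truncation puts f in both L^1 and L^2 and within reach of the sub-Markov property; f stays
    positive a.e. and below f0 a.e., so that [J0] controls its integrals. *)
Let f x := Num.min (Num.max (f0 x) 0) 1.

Let f01 x : 0 <= f x <= 1.
Proof. by rewrite /f le_min le_max lexx orbT ler01/= ge_min lexx orbT. Qed.

Let fn x : `|f x| <= 1.
Proof. by have /andP[? ?] := f01 x; rewrite ger0_norm. Qed.

Let f_gt0 : \forall x \ae mu, 0 < f x.
Proof.
by apply: filterS f0_gt0 => x h; rewrite /f lt_min lt_max h ltr01.
Qed.

Let f_le : \forall x \ae mu, f x <= f0 x.
Proof.
by apply: filterS f0_gt0 => x h; rewrite /f ge_min ge_max lexx ltW.
Qed.

Let f_L1 : L1 f.
Proof.
apply: (Lp1_le _ _ f0_L1).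
  by apply: measurable_minr => //; apply: measurable_maxr => //; exact: Lp_measurable f0_L1.
move=> x; have /andP[h _] := f01 x; rewrite ger0_norm// /f ge_min ge_max.
by rewrite ler_norm normr_ge0.
Qed.

Let f_L2 : L2 f. Proof. exact: Lp1_Lp2 f_L1 fn. Qed.

Let mf : measurable_fun setT f. Proof. exact: Lp_measurable f_L1. Qed.

Section test_function.
Variable w : T -> R.
Hypotheses (mw : measurable_fun setT w) (wf : forall x, 0 <= w x <= f x).

Lemma test01 x : 0 <= w x <= 1.
Proof.
have /andP[w0 wf'] := wf x; have /andP[_ f1] := f01 x.
by rewrite w0 (le_trans wf').
Qed.

Lemma test_L2 : L2 w.
Proof.
apply: (Lp2_le mw _ f_L2) => x.
by have /andP[w0 wf'] := wf x; have /andP[h _] := f01 x; rewrite !ger0_norm.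
Qed.

End test_function.

(* The error bounds the integral of e^(-at) T_t f over t >= N, since
   e^(-at) <= e^(-aN/2) e^(-at/2) there. *)
Lemma resolvent_le_integral a N : 0 < a ->
  weak_le mu f (G a f) (J0 N) (nrm1 f * (2 / a) * expR (- (a / 2)) ^+ N).
Proof.
move=> a0 w mw wf.
have w01 := test01 wf; have w2 := test_L2 mw wf.
have a2 : 0 < a / 2 by rewrite divr_gt0.
set K := nrm1 f * (2 / a) * expR (- (a / 2)) ^+ N.
have K0 : 0 <= K.
  rewrite /K mulr_ge0 ?exprn_ge0 ?expR_ge0// mulr_ge0 ?Lp_norm_ge0//.
  by rewrite divr_ge0// ltW.
(* The tail is dominated by [K] times the exponential density of rate a / 2, whose integral is 1;
   the factor 2 / a in [K] cancels the normalisation of the density. *)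
have irho := integrableZl_EFin K (integrable_exponential_pdf a2).
have irhoE : \int[@lebesgue_measure R]_t (K * exponential_pdf (a / 2) t) = K.
  rewrite RintegralZl//; last exact: integrable_exponential_pdf.
  by rewrite /Rintegral integral_exponential_pdf// mulr1.
have := integral_approx_integrable irho; rewrite irhoE => hrho.
have H1 := approx_L2 w2 a0 f_L2.
have H2 := integral_approxD (approx_L1 mw w01 f0_L1 (J0P N)) hrho.
apply: (integral_approx_le H1 H2) => t.
rewrite /= !patchE.
have rho0 : 0 <= K * exponential_pdf (a / 2) t.
  by rewrite mulr_ge0// exponential_pdf_ge0// ltW.
have [t0|t0] := ltP 0 t; last first.
  rewrite memNset/=; last by rewrite in_itv/= ltNge t0.
  rewrite memNset/=; last by rewrite in_itv/= ltNge t0.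
  by rewrite add0r.
rewrite mem_set/=; last by rewrite in_itv/= t0.
have Sf0 := ip_semigroup_ge0 mw w01 t0 f_L1 (aeW _ (fun x => proj1 (andP (f01 x)))).
have [tN|Nt] := ltP t N%:R.
  rewrite mem_set/=; last by rewrite in_itv/= t0.
  apply: ler_wpDr => //.
  apply: (@le_trans _ _ (ip mu (S t f) w)).
    rewrite ler_piMl// -expR0 ler_expR oppr_le0 mulr_ge0// ltW//.
  apply: ip_mono => //; [exact: S_L1|exact: S_L1|exact: S_mono].
rewrite memNset/=; last by rewrite in_itv/= t0/= ltNge Nt.
rewrite add0r exponential_pdfE; last exact: ltW.
have -> : K * (a / 2 * expR (- (a / 2) * t)) =
    (expR (- (a / 2)) ^+ N * expR (- (a / 2) * t)) * nrm1 f.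
  rewrite /K; have : a != 0 by rewrite gt_eqF.
  by move=> ?; field.
apply: ler_pM => //; [|exact: ip_semigroup_le].
rewrite -expRM_natl -expRD ler_expR.
have : N%:R * (a / 2) <= t * (a / 2) by rewrite ler_pM2r.
lra.
Qed.

(** A real-valued measurable version of the limit. The truncation at 0 keeps it real where [Gf0] is
    -oo, a value that [Gf0_lty] allows. *)
Let uf x := fine (limn_esup (fun N => (Num.max (J0 N x) 0)%:E)).

Let J0_meas N : measurable_fun setT (J0 N).
Proof. by have [/Lp_measurable] := J0P N. Qed.

Let maxJ0_meas N : measurable_fun setT (fun x => Num.max (J0 N x) 0).
Proof. exact: measurable_maxr. Qed.

Let uf_meas : measurable_fun setT uf.
Proof. exact: measurable_fine_limn_esup. Qed.

Let maxJ0_cvg : \forall x \ae mu, Num.max (J0 N x) 0 @[N --> \oo] --> uf x.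
Proof.
apply: filterS2 J0_cvg Gf0_lty => x cv fin.
suff [l cl] : exists l : R, Num.max (J0 N x) 0 @[N --> \oo] --> l.
  by rewrite /uf (fine_limn_esupE cl).
move: cv fin; case: (Gf0 x) => [r| |]// cv _.
  have cvr : J0 N x @[N --> \oo] --> r by exact: fine_cvg cv.
  exists ((r + 0 + `|r - 0|) / 2).
  under eq_fun do rewrite maxr_absE.
  apply: cvgMl; apply: cvgD; first by apply: cvgD => //; exact: cvg_cst.
  by apply: cvg_norm; apply: cvgB => //; exact: cvg_cst.
exists 0; apply: cvg_near_cst; move/cvgeNyPlt : cv => /(_ 0).
by apply: filterS => N; rewrite lte_fin => h; rewrite max_r// ltW.
Qed.

(** The weak comparison bounds the integral of f (G_a f - J0 N)^+ by an error tending to 0 with N.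
    By Fatou's lemma f (G_a f - uf)^+ vanishes a.e., and f > 0 a.e. *)
Lemma resolvent_le_potential a : 0 < a -> \forall x \ae mu, G a f x <= uf x.
Proof.
move=> a0.
have Gf2 := resolvent_L2 resolventG a0 f_L2.
have mGf := Lp_measurable Gf2.
have iG := ipE_integrable Gf2 f_L2.
have iJ N : mu.-integrable setT (EFin \o (J0 N \* f)).
  by apply: ip1_integrable => //; have [] := J0P N.
have f0' x : 0 <= f x by have /andP[] := f01 x.
pose z N x := f x * Num.max (G a f x - J0 N x) 0.
pose y N x := f x * Num.max (G a f x - Num.max (J0 N x) 0) 0.
pose e N := nrm1 f * (2 / a) * expR (- (a / 2)) ^+ N.
have zP N := weak_le_excess mf f0' mGf (J0_meas N) iG (iJ N) (resolvent_le_integral N a0).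
have y0 N x : 0 <= y N x by rewrite /y mulr_ge0// le_max lexx orbT.
have yz N x : y N x <= z N x.
  rewrite ler_wpM2l// ge_max !le_max lexx !orbT/=; apply/orP; left.
  by rewrite lerD2l lerN2 le_max lexx.
have ym N : measurable_fun setT (y N).
  apply: measurable_funM => //; apply: measurable_maxr => //.
  exact: measurable_funB.
have ye N : (\int[mu]_x (y N x)%:E <= (e N)%:E)%E.
  have [iz ze] := zP N.
  apply: (@le_trans _ _ (\int[mu]_x (z N x)%:E)%E).
    apply: ge0_le_integral => //.
    - by move=> x _; rewrite lee_fin.
    - exact/measurable_EFinP.
    - exact: (measurable_int mu iz).
    - by move=> x _; rewrite lee_fin.
  by rewrite -(fineK (integrable_fin_num measurableT iz)) lee_fin.
have e0 : (e N)%:E @[N --> \oo] --> 0%E.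
  apply: cvg_EFin; first exact: nearW.
  rewrite -[X in _ --> X](mulr0 (nrm1 f * (2 / a))); apply: cvgMr.
  apply: cvg_expr; rewrite ger0_norm ?expR_ge0// -expR0 ltr_expR.
  by rewrite oppr_lt0 divr_gt0.
have ymE N : measurable_fun setT (EFin \o y N) by exact/measurable_EFinP.
have := @fatou _ _ _ mu setT measurableT (fun N x => (y N x)%:E) ymE
  (fun N x _ => eqbRL (lee_fin _ _) (y0 N x)).
have -> : limn_einf (fun N => \int[mu]_x (y N x)%:E)%E = 0%E.
  apply: (cvg_limn_einf_sup _).1.
  apply: squeeze_cvge (cvg_cst 0%E) e0; apply: nearW => N.
  by rewrite ye integral_ge0// => x _; rewrite lee_fin.
have yl0 x : (0 <= limn_einf (fun N => (y N x)%:E))%E.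
  rewrite limn_einf_lim; apply: lime_ge; first exact: is_cvg_einfs.
  apply: nearW => n; apply: le_ereal_inf_tmp => _ [m _ <-].
  by rewrite lee_fin.
have myl : measurable_fun setT (fun x => limn_einf (fun N => (y N x)%:E)).
  rewrite /limn_einf; apply: measurableT_comp => //.
  by apply: measurable_fun_limn_esup => N; apply: measurableT_comp => //; exact: ymE.
move=> int0.
have : ae_eq mu setT (fun x => limn_einf (fun N => (y N x)%:E)) (cst 0%E).
  apply/(ae_eq_integral_abs mu measurableT myl).
  under eq_integral do rewrite gee0_abs//.
  by apply/eqP; rewrite eq_le int0 integral_ge0.
apply: filterS3 f_gt0 maxJ0_cvg => x fx cv /(_ I).
have yc : (y N x)%:E @[N --> \oo] --> (f x * Num.max (G a f x - uf x) 0)%:E.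
  apply: cvg_EFin; first exact: nearW.
  apply: cvgMr; under eq_fun do rewrite maxr_absE.
  rewrite maxr_absE; apply: cvgMl.
  have h : G a f x - Num.max (J0 N x) 0 @[N --> \oo] --> G a f x - uf x.
    by apply: cvgB => //; exact: cvg_cst.
  apply: cvgD; first by apply: cvgD => //; exact: cvg_cst.
  by apply: cvg_norm; apply: cvgB => //; exact: cvg_cst.
rewrite (cvg_limn_einf_sup yc).1 => -[] /eqP; rewrite mulf_eq0 gt_eqF//= => /eqP.
by have [|] := leP (G a f x - uf x) 0; lra.
Qed.

(** * The weighted function and its bounded potential *)

Let v x := Num.max (uf x) 0.
Let g x := (1 + v x) ^- 2 * f x.

Let v0 x : 0 <= v x. Proof. by rewrite /v le_max lexx orbT. Qed.

Let resolvent_g a : 0 < a -> L2 g /\ \forall x \ae mu, G a g x <= 1.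
Proof.
move=> a0; apply: (resolvent_bound resolventG markovG a0 f_L2 f01) => //.
  exact: measurable_maxr.
apply: filterS (resolvent_le_potential a0) => x /le_trans; apply.
by rewrite /v le_max lexx.
Qed.

Let g_L2 : L2 g. Proof. exact: (resolvent_g ltr01).1. Qed.

Let g01 x : 0 <= g x <= f x.
Proof.
have /andP[f_ge0 _] := f01 x.
have v1 : 0 < (1 + v x) ^+ 2 by rewrite exprn_gt0// ltr_pwDl.
rewrite /g mulr_ge0//= ?invr_ge0 ?(ltW v1)// ler_piMl// invf_le1//.
by rewrite exprn_ege1// lerDl.
Qed.

Let g_ge0 x : 0 <= g x. Proof. by have /andP[] := g01 x. Qed.

Let g_L1 : L1 g.
Proof.
apply: (Lp1_le _ _ f_L1) => [|x]; first exact: Lp_measurable g_L2.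
by have /andP[? ?] := g01 x; have /andP[? _] := f01 x; rewrite !ger0_norm.
Qed.

Let integral_g_exists : exists J : nat -> T -> R, forall N,
  is_bochner_integral L1 nrm1 `]0, N%:R[ (fun t => S t g) (J N).
Proof.
suff /choice[J JP] : forall N : nat, exists h,
    is_bochner_integral L1 nrm1 `]0, N%:R[ (fun t => S t g) h by exists J.
move=> N; apply: bochner_integral_exists => [t t0|]; first exact: S_L1.
apply: semigroup_L1_continuous => //; first by move=> t t0; exact: S_L2.
by case: semigroupS => -[_ _ +] _; exact.
Qed.

Section integral_g.
Variable J : nat -> T -> R.
Hypothesis JP : forall N,
  is_bochner_integral L1 nrm1 `]0, N%:R[ (fun t => S t g) (J N).

Let J_L1 N : L1 (J N). Proof. by have [] := JP N. Qed.

Let Jf N : mu.-integrable setT (EFin \o (J N \* f)).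
Proof. exact: ip1_integrable. Qed.

Let f_ge0 x : 0 <= f x. Proof. by have /andP[] := f01 x. Qed.

Let Sg_ge0 (w : T -> R) t : measurable_fun setT w -> (forall x, 0 <= w x <= f x) -> 0 < t ->
  0 <= ip mu (S t g) w.
Proof.
by move=> mw wf t0; apply: ip_semigroup_ge0 => //; [exact: test01|exact: aeW].
Qed.

Lemma integral_g_ge0 N : \forall x \ae mu, 0 <= J N x.
Proof.
have z1 : L1 (cst 0) by exact: Lp_cst0.
apply: (@weak_le_ae _ _ _ mu f mf f_ge0 (cst 0) (J N)) => //.
- exact: Lp_measurable (J_L1 N).
- exact: ip1_integrable.
move=> w mw wf; rewrite addr0.
have w01 := test01 wf.
have -> : ip mu (cst 0) w = 0.
  by rewrite /ip; under eq_Rintegral do rewrite mul0r; rewrite Rintegral_cst// mul0r.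
have := @integral_approx_integrable R (cst 0) ((Lp1P _ _).1 (Lp_cst0 _ p1)).
rewrite Rintegral_cst// mul0r => H0.
apply: (integral_approx_le H0 (approx_L1 mw w01 g_L1 (JP N))) => t.
rewrite patchE; case: ifPn => // /set_mem/=; rewrite in_itv/= => /andP[t0 _].
exact: Sg_ge0.
Qed.

Lemma integral_g_nd N : \forall x \ae mu, J N x <= J N.+1 x.
Proof.
apply: (@weak_le_ae _ _ _ mu f mf f_ge0) => //.
- exact: Lp_measurable (J_L1 N).
- exact: Lp_measurable (J_L1 N.+1).
move=> w mw wf; rewrite addr0.
have w01 := test01 wf.
apply: (integral_approx_le (approx_L1 mw w01 g_L1 (JP N))
  (approx_L1 mw w01 g_L1 (JP N.+1))) => t.
rewrite !patchE; case: ifPn => [/set_mem/=|_].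
  rewrite in_itv/= => /andP[t0 tN]; rewrite mem_set//= in_itv/= t0/=.
  by apply: lt_le_trans tN _; rewrite ler_nat.
case: ifPn => // /set_mem/=; rewrite in_itv/= => /andP[t0 _].
exact: Sg_ge0.
Qed.

Lemma integral_g_le N : \forall x \ae mu, J N x <= expR 1.
Proof.
(* N + 1 in place of N covers N = 0; on []0, N[] the exponent 1 - t / (N + 1) is still
   nonnegative. *)
have a0 : 0 < N.+1%:R^-1 :> R by rewrite invr_gt0 ltr0n.
set a := N.+1%:R^-1 in a0.
have [_ Gg1] := resolvent_g a0.
have Gg2 := resolvent_L2 resolventG a0 g_L2.
have eG2 : L2 (expR 1 *: G a g) by exact: LpZ.
have : \forall x \ae mu, J N x <= (expR 1 *: G a g) x.
  apply: (@weak_le_ae _ _ _ mu f mf f_ge0) => //.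
  - exact: Lp_measurable (J_L1 N).
  - exact: Lp_measurable eG2.
  - exact: ipE_integrable.
  move=> w mw wf; rewrite addr0.
  have w01 := test01 wf; have w2 := test_L2 mw wf.
  have ew2 : L2 (expR 1 *: w) by exact: LpZ.
  (* The constant e is moved into the test function, of which [approx_L2] asks only square
     integrability. *)
  have -> : ip mu (expR 1 *: G a g) w = ip mu (G a g) (expR 1 *: w).
    by apply: eq_Rintegral => x _; rewrite -[LHS]/(expR 1 * G a g x * w x) mulrAC mulrC.
  apply: (integral_approx_le (approx_L1 mw w01 g_L1 (JP N)) (approx_L2 ew2 a0 g_L2)) => t.
  rewrite !patchE.
  have [t0|t0] := ltP 0 t; last first.
    rewrite memNset/=; last by rewrite in_itv/= ltNge t0.
    by rewrite memNset/= ?in_itv/= ?ltNge ?t0.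
  have St0 := Sg_ge0 mw wf t0.
  have -> : ip mu (S t g) (expR 1 *: w) = expR 1 * ip mu (S t g) w.
    rewrite /ip -RintegralZl//; last exact: (ipE_integrable (S_L2 t0 g_L2) w2).
    by apply: eq_Rintegral => x _; rewrite -[LHS]/(S t g x * (expR 1 * w x)) mulrCA.
  rewrite [X in _ <= X]ifT; last by rewrite mem_set//= in_itv/= t0.
  rewrite mulrA -expRD; case: ifPn => [/set_mem/=|_]; last first.
    by rewrite mulr_ge0// expR_ge0.
  rewrite in_itv/= => /andP[_ tN]; rewrite ler_peMl// -expR0 ler_expR.
  rewrite addrC subr_ge0 /a mulrC ler_pdivrMr ?ltr0n// expR0 mul1r.
  by apply: ltW; apply: lt_trans tN _; rewrite ltr_nat.
apply: filterS2 Gg1 => x Gx; rewrite -[X in _ <= X -> _]/(expR 1 * G a g x).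
move=> /le_trans; apply.
by rewrite -[leRHS]mulr1 ler_wpM2l// expR_ge0.
Qed.

End integral_g.

(** The integrals [J N] increase a.e. and stay between 0 and e, so the potential has a real-valued
    version bounded by e. *)
Lemma bounded_potential_exists : exists h : T -> R,
  [/\ L1 h, ae_bounded mu h, \forall x \ae mu, 0 < h x &
      exists2 Gh : T -> R, Lp mu +oo%E Gh & is_potential mu S h (EFin \o Gh)].
Proof.
have [J JP] := integral_g_exists.
have JH : \forall x \ae mu, forall N,
    [/\ 0 <= J N x, J N x <= J N.+1 x & J N x <= expR 1].
  apply: ae_foralln => N.
  by apply: filterS3 (integral_g_ge0 JP N) (integral_g_nd JP N) (integral_g_le JP N).
pose Gg x := fine (limn_esup (fun N => (J N x)%:E)).
have mGg : measurable_fun setT Gg.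
  by apply: measurable_fine_limn_esup => N; have [/Lp_measurable] := JP N.
have GgP : \forall x \ae mu, J N x @[N --> \oo] --> Gg x /\ `|Gg x| <= expR 1.
  apply: filterS JH => x Jx.
  have cJ : cvgn (fun N => J N x).
    apply: nondecreasing_is_cvgn; first by apply/nondecreasing_seqP => N; have [] := Jx N.
    by exists (expR 1) => _ [N _ <-]; have [] := Jx N.
  have e : Gg x = limn (fun N => J N x) by apply: fine_limn_esupE.
  rewrite e; split => //; rewrite ger0_norm.
    by apply: limr_le => //; apply: nearW => N; have [] := Jx N.
  by apply: limr_ge => //; apply: nearW => N; have [] := Jx N.
exists g; split => //.
- exists 1; apply: aeW => x; rewrite ger0_norm//.
  by have /andP[_ gf] := g01 x; have /andP[_ f1] := f01 x; exact: le_trans f1.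
- apply: filterS f_gt0 => x fx; rewrite /g mulr_gt0// invr_gt0 exprn_gt0//.
  by rewrite ltr_pwDl.
exists Gg.
  rewrite /Lp/= inE; apply/andP; split; rewrite inE//= /finite_norm unlock.
  case: ifPn => // _; apply: (@le_lt_trans _ _ (expR 1)%:E); last exact: ltry.
  by apply/ess_supP; apply: filterS GgP => x [_]; rewrite lee_fin.
exists J; split => //.
apply: filterS GgP => x [cv _]; apply: cvg_EFin => //; exact: nearW.
Qed.

End transient.

End potential.

Theorem lemma6 (R : realType) (E : ptopologicalType)
  (hausdorffE : hausdorff_space E)
  (borelE : borel_generated_by_continuous R E)
  (mu : {sigma_finite_measure set (borel E) -> \bar R})
  (A : (borel E -> R) -> (borel E -> R) -> R) (V : set (borel E -> R))
  (dirichletA : dirichlet_form mu A V)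
  (DLambda : set (borel E -> R)) (Lambda : (borel E -> R) -> borel E -> R)
  (U : R -> (borel E -> R) -> borel E -> R)
  (semigroupU : C0_contraction_semigroup mu (Lp mu 2%:E) (Lp_norm mu 2%:E) U)
  (markovU : forall t, 0 < t -> sub_markovian mu (U t))
  (generatorU : generates (Lp mu 2%:E) (Lp_norm mu 2%:E) DLambda Lambda U)
  (restrictionU : C0_semigroup mu V (form_norm mu A) U)
  (G Gh : R -> (borel E -> R) -> borel E -> R)
  (resolventG : C0_contraction_resolvent mu (Lp mu 2%:E) (Lp_norm mu 2%:E) G)
  (markovG : forall a, 0 < a -> sub_markovian mu (fun f => a *: G a f))
  (formG : resolvent_of_form mu A V DLambda Lambda G)
  (adjointG : forall a, 0 < a -> adjoint_on_L2 mu (G a) (Gh a))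
  (T Th : R -> (borel E -> R) -> borel E -> R)
  (semigroupT : C0_contraction_semigroup mu (Lp mu 2%:E) (Lp_norm mu 2%:E) T)
  (resolventT : resolvent_of_semigroup (Lp mu 2%:E) (Lp_norm mu 2%:E) T G)
  (semigroupTh : C0_contraction_semigroup mu (Lp mu 2%:E) (Lp_norm mu 2%:E) Th)
  (resolventTh : resolvent_of_semigroup (Lp mu 2%:E) (Lp_norm mu 2%:E) Th Gh)
  (markovTh : forall t, 0 < t -> sub_markovian mu (Th t))
  (* T also denotes the extension of the semigroup to L^1 *)
  (semigroupT1 : contraction_semigroup mu (Lp mu 1%E) (Lp_norm mu 1%E) T)
  (positiveT1 : forall t, 0 < t -> positivity_preserving mu (Lp mu 1%E) (T t))
  (transientT : transient mu T) :
  exists g : borel E -> R,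
    [/\ Lp mu 1%E g, ae_bounded mu g,
        \forall x \ae mu, 0 < g x &
        exists2 Gg : borel E -> R, Lp mu +oo%E Gg &
          is_potential mu T g (EFin \o Gg)].
Proof.
have [f0 [Gf0 [f0_L1 f0_gt0 [J0 [J0P J0_cvg]] Gf0_lty]]] := transientT.
exact: (bounded_potential_exists resolventG markovG semigroupT resolventT
  semigroupT1 positiveT1 f0_L1 f0_gt0 J0P J0_cvg Gf0_lty).
Qed.
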